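(* The systems $\mathbf{IPF}^{IR}$ and $\mathbf{IPF}^{\iota R}$ are equivalent: under the notational correspondence identifying $Ix[F,\exists!x]$ with $\exists!\iota xF$ and $Ix[F,x=t]$ with $\iota xF=t$, every rule and axiom of each system is derivable in the other, so that a formula is derivable from given assumptions in one system iff its counterpart is derivable from the counterparts of the assumptions in the other.
   Context: $\mathbf{IPF}$ is natural deduction intuitionist positive free logic: a first-order language without function symbols, terms constants and parameters, primitive predicate $\exists!$ (''exists''), identity; standard intuitionist rules for $\land,\rightarrow,\lor,\leftrightarrow$, $\bot E$ to atomic conclusions; $\forall I$ (infer $\forall xA$ from a deduction of $A^x_a$, discharging $\exists!a$, $a$ fresh), $\forall E$ (from $\forall xA$, $\exists!t$ infer $A^x_t$), $\exists I$ (from $A^x_t$, $\exists!t$ infer $\exists xA$), $\exists E$ (from $\exists xA$ and a deduction of $C$ from $A^x_a,\exists!a$ infer $C$, discharging them, $a$ fresh); $=I$ (axiom $t=t$); $=E$/Leibniz's Law (from $t_1=t_2$ and $A^x_{t_1}$ infer $A^x_{t_2}$, $A$ atomic). $\mathbf{IPF}^\iota$ adds terms $\iota xF$ (''the $F$'') and the axiom (Lambert's Law) $\forall y(\iota xF=y\leftrightarrow\forall x(F\leftrightarrow x=y))$ for distinct $x,y$; there $t$ ranges also over $\iota$-terms. $\mathbf{IPF}^I$ instead adds formulas $Ix[F,G]$ (''the $F$ is $G$'', binding $x$) with rules ($a,b$ fresh parameters, $a\ne t$): $II$: from $F^x_t,G^x_t,\exists!t$ and a deduction of $a=t$ from $F^x_a,\exists!a$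 (discharged) infer $Ix[F,G]$; $IE^{1p}$: from $Ix[F,G]$, $F^x_t$, $\exists!t$, a deduction of $a=t$ from $F^x_a,\exists!a$ and a deduction of $C$ from $F^x_b,G^x_b,\exists!b$ (discharged) infer $C$; $IE^{2p}$: from $Ix[F,\exists!x],\exists!t_1,\exists!t_2,F^x_{t_1},F^x_{t_2},A^x_{t_1}$ infer $A^x_{t_2}$ ($A$ atomic); $IE^{3p}$: from $Ix[F,\exists!x]$ and a deduction of $C$ from $F^x_a,\exists!a$ (discharged) infer $C$; $IE^{4p}$: from $Ix[F,x=t_2],\exists!t_1,\exists!t_2,F^x_{t_1},A^x_{t_1}$ infer $A^x_{t_2}$ ($A$ atomic); $IE^{5p}$: from $Ix[F,x=t],\exists!t$ and a deduction of $C$ from $F^x_a,\exists!a$ (discharged) infer $C$. $\mathbf{IPF}^{IR}$ and $\mathbf{IPF}^{\iota R}$ are $\mathbf{IPF}^I$ and $\mathbf{IPF}^\iota$ with two restrictions: (1) in $Ix[F,G]$, $G$ is either $\exists!x$ or an identity $x=t$, and correspondingly $\iota$-terms occur only as the argument of $\exists!$ or on one side (not both) of an identity; (2) Leibniz's Law is restricted to constants and parameters.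
   Formalization: The literal claim fails; here Leibniz's Law in the ι-system replaces only a constant or parameter but may replace it by an ι-term, Ix[F,∃!x] and Ix[F,x=t] count as atomic, and an ι-term is never substituted for a variable inside another ι-term. *)

(* Defs.v *)
From Stdlib Require Vector.
From Stdlib Require Import List.
Import ListNotations.

Set Implicit Arguments.
Unset Strict Implicit.

Record signature := Signature {
  pred : Type;
  arity : pred -> nat;
  const : Type
}.

(** Bound variables are well-scoped de Bruijn indices: [fin n] are the [n]
    variables bound above a subexpression, [None] being the innermost.  A sentence
    is a formula of scope [0]; its only terms are constants and parameters. *)
Fixpoint fin (n : nat) : Type :=
  match n with 0 => Empty_set | S m => option (fin m) end.

Inductive tm (Sg : signature) (n : nat) : Type :=
| Var (i : fin n)
| Cst (c : const Sg)
| Par (a : nat).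
Arguments Var {Sg n} i.
Arguments Cst {Sg n} c.
Arguments Par {Sg n} a.

Definition tm_subst {Sg n m} (s : fin n -> tm Sg m) (t : tm Sg n) : tm Sg m :=
  match t with Var i => s i | Cst c => Cst c | Par a => Par a end.

Definition var0 {Sg n} : tm Sg (S n) := @Var Sg (S n) None.

Definition shift_var {Sg n} (i : fin n) : tm Sg (S n) := @Var Sg (S n) (Some i).

Definition tm_shift {Sg n} : tm Sg n -> tm Sg (S n) := tm_subst shift_var.

Definition up {Sg n m} (s : fin n -> tm Sg m) : fin (S n) -> tm Sg (S m) :=
  fun i => match i with None => var0 | Some j => tm_shift (s j) end.

(** ** Sequents and derivability

    A sequent [(G, A)] stands for a deduction of [A] whose undischarged assumptions
    are among [G].  A system is given by its instances of rules, premises first.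
    [derives R H] is derivability by the rules [R] from the sequents [H]; so a rule
    with premises [ps] and conclusion [s] is a derived rule of the system [R] when
    [derives R (fun q => In q ps) s]. *)

Definition sequent (form : Type) : Type := (list form * form)%type.

Inductive derives (form : Type)
    (R : list (sequent form) -> sequent form -> Prop)
    (H : sequent form -> Prop) : sequent form -> Prop :=
| d_hyp s : H s -> derives R H s
| d_assume G A : In A G -> derives R H (G, A)
| d_weaken G D A : incl G D -> derives R H (G, A) -> derives R H (D, A)
| d_rule ps s : R ps s -> (forall p, In p ps -> derives R H p) -> derives R H s.

Definition derivable (form : Type)
    (R : list (sequent form) -> sequent form -> Prop)
    (T : form -> Prop) (A : form) : Prop :=
  exists G, (forall B, In B G -> T B) /\ derives R (fun _ => False) (G, A).

Definition map_sequent (f g : Type) (tr : f -> g) (s : sequent f) : sequent g :=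
  (List.map tr (fst s), tr (snd s)).

Definition image (f g : Type) (tr : f -> g) (T : f -> Prop) : g -> Prop :=
  fun B => exists2 A, T A & B = tr A.

(** ** The system with the binary quantifier [Ix[F,G]] *)

(** The admissible second arguments [G] of [Ix[F,G]]: [∃!x], or [x = t] with [x] not
    free in [t]; see [scope_form]. *)
Inductive scope (Sg : signature) (n : nat) : Type :=
| ScEx
| ScEq (t : tm Sg n).
Arguments ScEx {Sg n}.

Inductive formI (Sg : signature) : nat -> Type :=
| IPred n (P : pred Sg) (v : Vector.t (tm Sg n) (arity P)) : formI Sg n
| IExt n (t : tm Sg n) : formI Sg n
| IEq n (t s : tm Sg n) : formI Sg n
| IBot n : formI Sg n
| IAnd n (A B : formI Sg n) : formI Sg n
| IOr n (A B : formI Sg n) : formI Sg n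
| IImp n (A B : formI Sg n) : formI Sg n
| IIff n (A B : formI Sg n) : formI Sg n
| IAll n (A : formI Sg (S n)) : formI Sg n
| IEx n (A : formI Sg (S n)) : formI Sg n
| IThe n (F : formI Sg (S n)) (G : scope Sg n) : formI Sg n.
Arguments IBot {Sg n}.

Definition scope_subst {Sg n m} (s : fin n -> tm Sg m) (G : scope Sg n) : scope Sg m :=
  match G with ScEx => ScEx | ScEq t => ScEq (tm_subst s t) end.

Definition scope_form {Sg n} (G : scope Sg n) : formI Sg (S n) :=
  match G with
  | ScEx => IExt var0
  | ScEq t => IEq var0 (tm_shift t)
  end.

Fixpoint substI {Sg n m} (s : fin n -> tm Sg m) (A : formI Sg n) {struct A} : formI Sg m :=
  match A in formI _ n return (fin n -> tm Sg m) -> formI Sg m with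
  | IPred v => fun s => IPred (Vector.map (tm_subst s) v)
  | IExt t => fun s => IExt (tm_subst s t)
  | IEq t u => fun s => IEq (tm_subst s t) (tm_subst s u)
  | IBot => fun _ => IBot
  | IAnd A B => fun s => IAnd (substI s A) (substI s B)
  | IOr A B => fun s => IOr (substI s A) (substI s B)
  | IImp A B => fun s => IImp (substI s A) (substI s B)
  | IIff A B => fun s => IIff (substI s A) (substI s B)
  | IAll A => fun s => IAll (substI (up s) A)
  | IEx A => fun s => IEx (substI (up s) A)
  | IThe F G => fun s => IThe (substI (up s) F) (scope_subst s G)
  end s.

(** [A^x_t], where [x] is the only variable that may be free in [A]. *)
Definition instI {Sg} (A : formI Sg 1) (t : tm Sg 0) : formI Sg 0 := substI (fun _ => t) A.

Definition occurs_scope {Sg n} (a : nat) (G : scope Sg n) : Prop :=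
  match G with ScEx => False | ScEq t => t = Par a end.

Fixpoint occursI {Sg n} (a : nat) (A : formI Sg n) : Prop :=
  match A with
  | IPred v => Vector.In (Par a) v
  | IExt t => t = Par a
  | IEq t u => t = Par a \/ u = Par a
  | IBot => False
  | IAnd A B | IOr A B | IImp A B | IIff A B => occursI a A \/ occursI a B
  | IAll A | IEx A => occursI a A
  | IThe F G => occursI a F \/ occurs_scope a G
  end.

Definition fresh_ctxI {Sg} (a : nat) (G : list (formI Sg 0)) : Prop :=
  forall B, In B G -> ~ occursI a B.

(** [Ix[F,∃!x]] and [Ix[F,x = t]] are identified with [∃!ιxF] and [ιxF = t], and so
    count as atomic. *)
Definition atomicI {Sg n} (A : formI Sg n) : Prop :=
  match A with
  | IPred _ | IExt _ | IEq _ _ | IThe _ _ => True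
  | _ => False
  end.

Inductive IPF_IR (Sg : signature) :
    list (sequent (formI Sg 0)) -> sequent (formI Sg 0) -> Prop :=
| I_andI G A B : IPF_IR [(G, A); (G, B)] (G, IAnd A B)
| I_andE1 G A B : IPF_IR [(G, IAnd A B)] (G, A)
| I_andE2 G A B : IPF_IR [(G, IAnd A B)] (G, B)
| I_impI G A B : IPF_IR [(A :: G, B)] (G, IImp A B)
| I_impE G A B : IPF_IR [(G, IImp A B); (G, A)] (G, B)
| I_orI1 G A B : IPF_IR [(G, A)] (G, IOr A B)
| I_orI2 G A B : IPF_IR [(G, B)] (G, IOr A B)
| I_orE G A B C : IPF_IR [(G, IOr A B); (A :: G, C); (B :: G, C)] (G, C)
| I_iffI G A B : IPF_IR [(A :: G, B); (B :: G, A)] (G, IIff A B)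
| I_iffE1 G A B : IPF_IR [(G, IIff A B); (G, A)] (G, B)
| I_iffE2 G A B : IPF_IR [(G, IIff A B); (G, B)] (G, A)
| I_botE G A : atomicI A -> IPF_IR [(G, IBot)] (G, A)
| I_allI G A a :
    fresh_ctxI a G -> ~ occursI a A ->
    IPF_IR [(IExt (Par a) :: G, instI A (Par a))] (G, IAll A)
| I_allE G A t : IPF_IR [(G, IAll A); (G, IExt t)] (G, instI A t)
| I_exI G A t : IPF_IR [(G, instI A t); (G, IExt t)] (G, IEx A)
| I_exE G A C a :
    fresh_ctxI a G -> ~ occursI a A -> ~ occursI a C ->
    IPF_IR [(G, IEx A); (instI A (Par a) :: IExt (Par a) :: G, C)] (G, C)
| I_eqI G t : IPF_IR [] (G, IEq t t)
| I_eqE G A t1 t2 :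
    atomicI A -> IPF_IR [(G, IEq t1 t2); (G, instI A t1)] (G, instI A t2)
| I_theI G F (K : scope Sg 0) t a :
    fresh_ctxI a G -> ~ occursI a F -> t <> Par a ->
    IPF_IR [(G, instI F t); (G, instI (scope_form K) t); (G, IExt t);
            (instI F (Par a) :: IExt (Par a) :: G, IEq (Par a) t)]
           (G, IThe F K)
| I_theE1 G F (K : scope Sg 0) t C a b :
    fresh_ctxI a G -> ~ occursI a F -> t <> Par a ->
    fresh_ctxI b G -> ~ occursI b F -> ~ occurs_scope b K -> ~ occursI b C ->
    IPF_IR [(G, IThe F K); (G, instI F t); (G, IExt t);
            (instI F (Par a) :: IExt (Par a) :: G, IEq (Par a) t);
            (instI F (Par b) :: instI (scope_form K) (Par b) :: IExt (Par b) :: G, C)]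
           (G, C)
| I_theE2 G F t1 t2 A :
    atomicI A ->
    IPF_IR [(G, IThe F ScEx); (G, IExt t1); (G, IExt t2);
            (G, instI F t1); (G, instI F t2); (G, instI A t1)]
           (G, instI A t2)
| I_theE3 G F C a :
    fresh_ctxI a G -> ~ occursI a F -> ~ occursI a C ->
    IPF_IR [(G, IThe F ScEx); (instI F (Par a) :: IExt (Par a) :: G, C)] (G, C)
| I_theE4 G F t1 t2 A :
    atomicI A ->
    IPF_IR [(G, IThe F (ScEq t2)); (G, IExt t1); (G, IExt t2);
            (G, instI F t1); (G, instI A t1)]
           (G, instI A t2)
| I_theE5 G F t C a :
    fresh_ctxI a G -> ~ occursI a F -> t <> Par a -> ~ occursI a C ->
    IPF_IR [(G, IThe F (ScEq t)); (G, IExt t);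
            (instI F (Par a) :: IExt (Par a) :: G, C)]
           (G, C).

(** ** The system with the term-forming operator [ι] *)

(** A [tmD] is a constant, parameter or variable, or an [ι]-term.  The grammar of
    [formD] lets an [ι]-term stand only as the argument of [∃!] or on one side of an
    identity, which is then written on the left: [DEq (TIota F) t]. *)
Inductive tmD (Sg : signature) : nat -> Type :=
| TSim n (t : tm Sg n) : tmD Sg n
| TIota n (F : formD Sg (S n)) : tmD Sg n
with formD (Sg : signature) : nat -> Type :=
| DPred n (P : pred Sg) (v : Vector.t (tm Sg n) (arity P)) : formD Sg n
| DExt n (t : tmD Sg n) : formD Sg n
| DEq n (t : tmD Sg n) (s : tm Sg n) : formD Sg n
| DBot n : formD Sg n
| DAnd n (A B : formD Sg n) : formD Sg n
| DOr n (A B : formD Sg n) : formD Sg n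
| DImp n (A B : formD Sg n) : formD Sg n
| DIff n (A B : formD Sg n) : formD Sg n
| DAll n (A : formD Sg (S n)) : formD Sg n
| DEx n (A : formD Sg (S n)) : formD Sg n.
Arguments DBot {Sg n}.

Fixpoint tmD_subst {Sg n m} (s : fin n -> tm Sg m) (t : tmD Sg n) {struct t} : tmD Sg m :=
  match t in tmD _ n return (fin n -> tm Sg m) -> tmD Sg m with
  | TSim t => fun s => TSim (tm_subst s t)
  | TIota F => fun s => TIota (substD (up s) F)
  end s
with substD {Sg n m} (s : fin n -> tm Sg m) (A : formD Sg n) {struct A} : formD Sg m :=
  match A in formD _ n return (fin n -> tm Sg m) -> formD Sg m with
  | DPred v => fun s => DPred (Vector.map (tm_subst s) v)
  | DExt t => fun s => DExt (tmD_subst s t)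
  | DEq t u => fun s => DEq (tmD_subst s t) (tm_subst s u)
  | DBot => fun _ => DBot
  | DAnd A B => fun s => DAnd (substD s A) (substD s B)
  | DOr A B => fun s => DOr (substD s A) (substD s B)
  | DImp A B => fun s => DImp (substD s A) (substD s B)
  | DIff A B => fun s => DIff (substD s A) (substD s B)
  | DAll A => fun s => DAll (substD (up s) A)
  | DEx A => fun s => DEx (substD (up s) A)
  end s.

Definition instD {Sg} (A : formD Sg 1) (t : tm Sg 0) : formD Sg 0 := substD (fun _ => t) A.

(** *** Substitution of [ι]-terms

    [isubstD s A] is defined only if the result respects the grammar: an [ι]-term
    may replace [x] where [x] is the argument of [∃!] or one side of an identity
    whose other side is not an [ι]-term (or [x] itself).  Variables that occur inside
    an [ι]-term may only be replaced by constants, parameters and variables; without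
    this the quantifier rules would make [ιyG = t], for [t] without existence,
    sensitive to [G] in a way for which [Iy[G,y = t]] has no rule. *)

Definition option_bind {A B : Type} (f : A -> option B) (o : option A) : option B :=
  match o with Some a => f a | None => None end.

Fixpoint vtraverse {A B : Type} (f : A -> option B) {k} (v : Vector.t A k) :
    option (Vector.t B k) :=
  match v with
  | Vector.nil _ => Some (Vector.nil B)
  | Vector.cons _ a _ w =>
      option_bind (fun b => option_map (fun w' => Vector.cons B b _ w') (vtraverse f w)) (f a)
  end.

Definition simple {Sg n} (t : tmD Sg n) : option (tm Sg n) :=
  match t with TSim t => Some t | TIota _ => None end.

Definition tm_isubst {Sg n m} (s : fin n -> option (tmD Sg m)) (t : tm Sg n) :
    option (tmD Sg m) :=
  match t with
  | Var i => s i
  | Cst c => Some (TSim (Cst c))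
  | Par a => Some (TSim (Par a))
  end.

Definition iup {Sg n m} (s : fin n -> option (tmD Sg m)) :
    fin (S n) -> option (tmD Sg (S m)) :=
  fun i => match i with
           | None => Some (TSim var0)
           | Some j => option_map (tmD_subst shift_var) (s j)
           end.

Definition simple_only {Sg n m} (s : fin n -> option (tmD Sg m)) :
    fin n -> option (tmD Sg m) :=
  fun i => option_map (@TSim Sg m) (option_bind simple (s i)).

Definition identity {Sg n} (t u : tmD Sg n) : option (formD Sg n) :=
  match t in tmD _ n return tmD Sg n -> option (formD Sg n) with
  | TSim t => fun u =>
      match u in tmD _ n return tm Sg n -> option (formD Sg n) with
      | TSim u => fun t => Some (DEq (TSim t) u)
      | TIota F => fun t => Some (DEq (TIota F) t)
      end t
  | TIota F => fun u => option_map (DEq (TIota F)) (simple u)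
  end u.

Definition option_map2 {A B C : Type} (f : A -> B -> C) (o : option A) (p : option B) :
    option C :=
  option_bind (fun a => option_map (f a) p) o.

Fixpoint tmD_isubst {Sg n m} (s : fin n -> option (tmD Sg m)) (t : tmD Sg n) {struct t} :
    option (tmD Sg m) :=
  match t in tmD _ n return (fin n -> option (tmD Sg m)) -> option (tmD Sg m) with
  | TSim t => fun s => tm_isubst s t
  | TIota F => fun s => option_map (@TIota Sg m) (isubstD (iup (simple_only s)) F)
  end s
with isubstD {Sg n m} (s : fin n -> option (tmD Sg m)) (A : formD Sg n) {struct A} :
    option (formD Sg m) :=
  match A in formD _ n return (fin n -> option (tmD Sg m)) -> option (formD Sg m) with
  | @DPred _ _ P v => fun s =>
      option_map (@DPred Sg m P) (vtraverse (fun t => option_bind simple (tm_isubst s t)) v)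
  | DExt t => fun s => option_map (@DExt Sg m) (tmD_isubst s t)
  | DEq t u => fun s =>
      option_bind (fun t' => option_bind (identity t') (tm_isubst s u)) (tmD_isubst s t)
  | DBot => fun _ => Some DBot
  | DAnd A B => fun s => option_map2 (@DAnd Sg m) (isubstD s A) (isubstD s B)
  | DOr A B => fun s => option_map2 (@DOr Sg m) (isubstD s A) (isubstD s B)
  | DImp A B => fun s => option_map2 (@DImp Sg m) (isubstD s A) (isubstD s B)
  | DIff A B => fun s => option_map2 (@DIff Sg m) (isubstD s A) (isubstD s B)
  | DAll A => fun s => option_map (@DAll Sg m) (isubstD (iup s) A)
  | DEx A => fun s => option_map (@DEx Sg m) (isubstD (iup s) A)
  end s.

(** [A^x_t] for [t] a constant, a parameter or an [ι]-term. *)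
Definition iinstD {Sg} (A : formD Sg 1) (t : tmD Sg 0) : option (formD Sg 0) :=
  isubstD (fun _ => Some t) A.

Fixpoint occurs_tmD {Sg n} (a : nat) (t : tmD Sg n) : Prop :=
  match t with
  | TSim t => t = Par a
  | TIota F => occursD a F
  end
with occursD {Sg n} (a : nat) (A : formD Sg n) : Prop :=
  match A with
  | DPred v => Vector.In (Par a) v
  | DExt t => occurs_tmD a t
  | DEq t u => occurs_tmD a t \/ u = Par a
  | DBot => False
  | DAnd A B | DOr A B | DImp A B | DIff A B => occursD a A \/ occursD a B
  | DAll A | DEx A => occursD a A
  end.

Definition fresh_ctxD {Sg} (a : nat) (G : list (formD Sg 0)) : Prop :=
  forall B, In B G -> ~ occursD a B.

Definition atomicD {Sg n} (A : formD Sg n) : Prop :=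
  match A with
  | DPred _ | DExt _ | DEq _ _ => True
  | _ => False
  end.

(** [∀y (ιxF = y ↔ ∀x (F ↔ x = y))]: in [F], [x] is variable 0 and [y] variable 1. *)
Definition Lambert {Sg} (F : formD Sg 2) : formD Sg 0 :=
  let y : tm Sg 1 := var0 in
  DAll (DIff (DEq (TIota F) y)
             (DAll (DIff F (DEq (TSim var0) (tm_shift y))))).

(** In [D_eqE] the term [t1] that is replaced is a constant or parameter, never an
    [ι]-term. *)
Inductive IPF_iotaR (Sg : signature) :
    list (sequent (formD Sg 0)) -> sequent (formD Sg 0) -> Prop :=
| D_andI G A B : IPF_iotaR [(G, A); (G, B)] (G, DAnd A B)
| D_andE1 G A B : IPF_iotaR [(G, DAnd A B)] (G, A)
| D_andE2 G A B : IPF_iotaR [(G, DAnd A B)] (G, B)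
| D_impI G A B : IPF_iotaR [(A :: G, B)] (G, DImp A B)
| D_impE G A B : IPF_iotaR [(G, DImp A B); (G, A)] (G, B)
| D_orI1 G A B : IPF_iotaR [(G, A)] (G, DOr A B)
| D_orI2 G A B : IPF_iotaR [(G, B)] (G, DOr A B)
| D_orE G A B C : IPF_iotaR [(G, DOr A B); (A :: G, C); (B :: G, C)] (G, C)
| D_iffI G A B : IPF_iotaR [(A :: G, B); (B :: G, A)] (G, DIff A B)
| D_iffE1 G A B : IPF_iotaR [(G, DIff A B); (G, A)] (G, B)
| D_iffE2 G A B : IPF_iotaR [(G, DIff A B); (G, B)] (G, A)
| D_botE G A : atomicD A -> IPF_iotaR [(G, DBot)] (G, A)
| D_allI G A a :
    fresh_ctxD a G -> ~ occursD a A ->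
    IPF_iotaR [(DExt (TSim (Par a)) :: G, instD A (Par a))] (G, DAll A)
| D_allE G A t B :
    iinstD A t = Some B ->
    IPF_iotaR [(G, DAll A); (G, DExt t)] (G, B)
| D_exI G A t B :
    iinstD A t = Some B ->
    IPF_iotaR [(G, B); (G, DExt t)] (G, DEx A)
| D_exE G A C a :
    fresh_ctxD a G -> ~ occursD a A -> ~ occursD a C ->
    IPF_iotaR [(G, DEx A); (instD A (Par a) :: DExt (TSim (Par a)) :: G, C)] (G, C)
| D_eqI G t : IPF_iotaR [] (G, DEq (TSim t) t)
| D_eqE G A (t1 : tm Sg 0) (t2 : tmD Sg 0) E B :
    atomicD A -> identity (TSim t1) t2 = Some E -> iinstD A t2 = Some B ->
    IPF_iotaR [(G, E); (G, instD A t1)] (G, B)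
| D_Lambert G F : IPF_iotaR [] (G, Lambert F).

(** ** The notational correspondence *)

Fixpoint I_to_iota {Sg n} (A : formI Sg n) : formD Sg n :=
  match A with
  | IPred v => DPred v
  | IExt t => DExt (TSim t)
  | IEq t s => DEq (TSim t) s
  | IBot => DBot
  | IAnd A B => DAnd (I_to_iota A) (I_to_iota B)
  | IOr A B => DOr (I_to_iota A) (I_to_iota B)
  | IImp A B => DImp (I_to_iota A) (I_to_iota B)
  | IIff A B => DIff (I_to_iota A) (I_to_iota B)
  | IAll A => DAll (I_to_iota A)
  | IEx A => DEx (I_to_iota A)
  | IThe F G =>
      match G with
      | ScEx => DExt (TIota (I_to_iota F))
      | ScEq t => DEq (TIota (I_to_iota F)) t
      end
  end.

Fixpoint iota_to_I {Sg n} (A : formD Sg n) : formI Sg n :=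
  match A with
  | DPred v => IPred v
  | DExt t =>
      match t with
      | TSim t => IExt t
      | TIota F => IThe (iota_to_I F) ScEx
      end
  | DEq t s =>
      match t in tmD _ n return tm Sg n -> formI Sg n with
      | TSim t => fun s => IEq t s
      | TIota F => fun s => IThe (iota_to_I F) (ScEq s)
      end s
  | DBot => IBot
  | DAnd A B => IAnd (iota_to_I A) (iota_to_I B)
  | DOr A B => IOr (iota_to_I A) (iota_to_I B)
  | DImp A B => IImp (iota_to_I A) (iota_to_I B)
  | DIff A B => IIff (iota_to_I A) (iota_to_I B)
  | DAll A => IAll (iota_to_I A)
  | DEx A => IEx (iota_to_I A)
  end.

(* Main.v *)
(** The two notations are in bijection, so it is enough to simulate the rules of each
    system in the other.

    In [IPF^ιR], Lambert's Law at an existing [t] says that [ιxF = t] holds iff [F^x_t]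
    holds and [t] is the only [F].  Since Leibniz's Law cannot replace [ιxF], facts about
    an existing [ιxF] come from instantiating theorems such as [∀x∃y(y = x)] and
    [∀x(t = x → x = u → t = u)] with it.

    In [IPF^IR], an existing [ιxF] has, by [IE3] and [IE2], a parameter [a] that is the
    only [F].  An induction on [A] shows that [A^x_a] and [A^x_ιxF] are then
    interderivable, which reduces the quantifier rules for [ιxF] to those for [a].  Both
    directions use Leibniz's Law for arbitrary formulas, which the atomic case yields. *)

Require Import Defs.
From Stdlib Require Vector.
From Stdlib Require Import List Lia.
Import ListNotations.

Set Implicit Arguments.
Unset Strict Implicit.

(** * Substitution *)

Section Substitution.
Context {Sg : signature}.

Lemma tm_subst_ext n m (s s' : fin n -> tm Sg m) (t : tm Sg n) :
  (forall i, s i = s' i) -> tm_subst s t = tm_subst s' t.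
Proof. destruct t; simpl; auto. Qed.

Lemma tm_subst_comp n m k (s : fin n -> tm Sg m) (r : fin m -> tm Sg k) (t : tm Sg n) :
  tm_subst r (tm_subst s t) = tm_subst (fun i => tm_subst r (s i)) t.
Proof. destruct t; reflexivity. Qed.

Lemma tm_subst_Var n (t : tm Sg n) : tm_subst (@Var Sg n) t = t.
Proof. destruct t; reflexivity. Qed.

Lemma tm_shift_inst (t u : tm Sg 0) : tm_subst (fun _ : fin 1 => u) (tm_shift t) = t.
Proof. destruct t as [[]| |]; reflexivity. Qed.

Lemma up_ext n m (s s' : fin n -> tm Sg m) :
  (forall i, s i = s' i) -> forall i, up s i = up s' i.
Proof. intros E [i|]; simpl; [rewrite E|]; reflexivity. Qed.

Lemma up_comp n m k (s : fin n -> tm Sg m) (r : fin m -> tm Sg k) (i : fin (S n)) :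
  tm_subst (up r) (up s i) = up (fun j => tm_subst r (s j)) i.
Proof. destruct i as [i|]; simpl; [destruct (s i)|]; reflexivity. Qed.

Lemma up_Var n (i : fin (S n)) : up (@Var Sg n) i = Var i.
Proof. destruct i; reflexivity. Qed.

Lemma substI_ext n (A : formI Sg n) :
  forall m (s s' : fin n -> tm Sg m), (forall i, s i = s' i) -> substI s A = substI s' A.
Proof.
  induction A; intros m s1 s2 E; simpl; f_equal; eauto using tm_subst_ext, up_ext.
  - apply Vector.map_ext; intro; apply tm_subst_ext, E.
  - destruct G; simpl; f_equal; apply tm_subst_ext, E.
Qed.

Lemma substI_comp n (A : formI Sg n) :
  forall m k (s : fin n -> tm Sg m) (r : fin m -> tm Sg k),
    substI r (substI s A) = substI (fun i => tm_subst r (s i)) A.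
Proof.
  induction A; intros m k s1 r; simpl; f_equal; auto using tm_subst_comp;
    try (rewrite IHA; apply substI_ext, up_comp).
  - rewrite Vector.map_map; apply Vector.map_ext; intro; apply tm_subst_comp.
  - destruct G; simpl; f_equal; apply tm_subst_comp.
Qed.

Lemma substI_Var n (A : formI Sg n) : substI (@Var Sg n) A = A.
Proof.
  induction A; simpl; f_equal; auto using tm_subst_Var;
    try (rewrite (substI_ext A (@up_Var n)); assumption).
  - rewrite (Vector.map_ext _ _ _ _ (@tm_subst_Var n)); apply Vector.map_id.
  - destruct G; simpl; f_equal; apply tm_subst_Var.
Qed.

(** Lets [ιxF = y] be treated as a formula in [y] alone: [F] is carried under the extra variable
    [y], which it does not mention, and comes back unchanged when [y] is instantiated. *)
Lemma substI_shift_inst (F : formI Sg 1) (t : tm Sg 0) :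
  substI (up (fun _ => t)) (substI (up shift_var) F) = F.
Proof.
  rewrite substI_comp; transitivity (substI (@Var Sg 1) F); [|apply substI_Var].
  apply substI_ext.
  intros [[]|]; reflexivity.
Qed.

Definition scons n m (t : tm Sg m) (s : fin n -> tm Sg m) (i : fin (S n)) : tm Sg m :=
  match i with None => t | Some j => s j end.

Lemma instI_up n (s : fin n -> tm Sg 0) (A : formI Sg (S n)) (c : tm Sg 0) :
  instI (substI (up s) A) c = substI (scons c s) A.
Proof.
  unfold instI; rewrite substI_comp; apply substI_ext.
  intros [i|]; simpl; [apply tm_shift_inst | reflexivity].
Qed.

(** The parameter chosen for the bound variable is absorbed into the substitution, and [t] is left
    as the only term still to be put in. Leibniz's Law passes a quantifier in this way. *)
Lemma instI_up_subst n (r : fin n -> tm Sg 1) (A : formI Sg (S n)) (t c : tm Sg 0) :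
  instI (substI (up (fun _ => t)) (substI (up r) A)) c
  = instI (substI (scons (tm_shift c) r) A) t.
Proof.
  rewrite instI_up; unfold instI; rewrite !substI_comp; apply substI_ext.
  intros [i|]; simpl.
  - destruct (r i); reflexivity.
  - rewrite tm_shift_inst; reflexivity.
Qed.

End Substitution.

(** * The correspondence *)

(* The induction principles generated by default give no hypothesis for the body of an [ι]-term. *)
Scheme tmD_formD_ind := Induction for tmD Sort Prop
with formD_tmD_ind := Induction for formD Sort Prop.

Section Correspondence.
Context {Sg : signature}.

Lemma I_to_iotaK n (A : formI Sg n) : iota_to_I (I_to_iota A) = A.
Proof.
  induction A; simpl; f_equal; auto.
  destruct G; simpl; f_equal; auto.
Qed.

(** With this, facts about [formD] reduce to inductions on [formI], which is not mutual. The
    predicate on terms asks for a preimage of the body of an [ι]-term and nothing of other terms. *)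
Lemma I_to_iota_surj n (A : formD Sg n) : exists B, A = I_to_iota B.
Proof.
  refine (@formD_tmD_ind Sg
    (fun n t => match t with TSim _ => True | TIota F => exists B, F = I_to_iota B end)
    (fun n A => exists B, A = I_to_iota B) _ _ _ _ _ _ _ _ _ _ _ _ n A);
    clear n A; auto.
  - intros n P v; exists (IPred v); reflexivity.
  - intros n [n' t|n' F]; [intros _; exists (IExt t)|intros [B ->]; exists (IThe B ScEx)];
      reflexivity.
  - intros n [n' t|n' F]; [intros _ s; exists (IEq t s)
      |intros [B ->] s; exists (IThe B (ScEq s))]; reflexivity.
  - intros n; exists IBot; reflexivity.
  - intros n A [A' ->] B [B' ->]; exists (IAnd A' B'); reflexivity.
  - intros n A [A' ->] B [B' ->]; exists (IOr A' B'); reflexivity.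
  - intros n A [A' ->] B [B' ->]; exists (IImp A' B'); reflexivity.
  - intros n A [A' ->] B [B' ->]; exists (IIff A' B'); reflexivity.
  - intros n A [A' ->]; exists (IAll A'); reflexivity.
  - intros n A [A' ->]; exists (IEx A'); reflexivity.
Qed.

Lemma iota_to_IK n (A : formD Sg n) : I_to_iota (iota_to_I A) = A.
Proof. destruct (I_to_iota_surj A) as [B ->]; rewrite I_to_iotaK; reflexivity. Qed.

Lemma I_to_iota_subst n (A : formI Sg n) :
  forall m (s : fin n -> tm Sg m), I_to_iota (substI s A) = substD s (I_to_iota A).
Proof.
  induction A; intros m s1; simpl; f_equal; auto.
  destruct G; simpl; f_equal; f_equal; auto.
Qed.

Lemma I_to_iota_inst (A : formI Sg 1) (t : tm Sg 0) :
  I_to_iota (instI A t) = instD (I_to_iota A) t.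
Proof. apply I_to_iota_subst. Qed.

Lemma iota_to_I_inst (A : formD Sg 1) (t : tm Sg 0) :
  iota_to_I (instD A t) = instI (iota_to_I A) t.
Proof.
  destruct (I_to_iota_surj A) as [B ->].
  rewrite <- I_to_iota_inst, !I_to_iotaK; reflexivity.
Qed.

Lemma occurs_I_to_iota a n (A : formI Sg n) : occursD a (I_to_iota A) <-> occursI a A.
Proof.
  induction A; simpl; try tauto.
  destruct G; simpl; tauto.
Qed.

Lemma occurs_iota_to_I a n (A : formD Sg n) : occursI a (iota_to_I A) <-> occursD a A.
Proof. rewrite <- occurs_I_to_iota, iota_to_IK; tauto. Qed.

Lemma fresh_I_to_iota a (G : list (formI Sg 0)) :
  fresh_ctxI a G -> fresh_ctxD a (map I_to_iota G).
Proof.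
  intros HG B HB; apply in_map_iff in HB as [C [<- HC]].
  rewrite occurs_I_to_iota; auto.
Qed.

Lemma fresh_iota_to_I a (G : list (formD Sg 0)) :
  fresh_ctxD a G -> fresh_ctxI a (map iota_to_I G).
Proof.
  intros HG B HB; apply in_map_iff in HB as [C [<- HC]].
  rewrite occurs_iota_to_I; auto.
Qed.

Lemma atomic_I_to_iota n (A : formI Sg n) : atomicI A -> atomicD (I_to_iota A).
Proof. destruct A; simpl; try tauto; destruct G; simpl; auto. Qed.

Lemma atomic_iota_to_I n (A : formD Sg n) : atomicD A -> atomicI (iota_to_I A).
Proof.
  destruct (I_to_iota_surj A) as [B ->]; rewrite I_to_iotaK.
  destruct B; simpl; tauto.
Qed.

Lemma tmD_subst_comp n m k (s : fin n -> tm Sg m) (r : fin m -> tm Sg k) (t : tmD Sg n) :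
  tmD_subst r (tmD_subst s t) = tmD_subst (fun i => tm_subst r (s i)) t.
Proof.
  destruct t as [n t|n F]; simpl; f_equal; [apply tm_subst_comp|].
  destruct (I_to_iota_surj F) as [B ->].
  rewrite <- !I_to_iota_subst, substI_comp; f_equal; apply substI_ext, up_comp.
Qed.

Lemma tmD_subst_ext n m (s s' : fin n -> tm Sg m) (t : tmD Sg n) :
  (forall i, s i = s' i) -> tmD_subst s t = tmD_subst s' t.
Proof.
  destruct t as [n t|n F]; simpl; intro E; f_equal; [apply tm_subst_ext, E|].
  destruct (I_to_iota_surj F) as [B ->].
  rewrite <- !I_to_iota_subst; f_equal; apply substI_ext, up_ext, E.
Qed.

Lemma tmD_subst_Var n (t : tmD Sg n) : tmD_subst (@Var Sg n) t = t.
Proof.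
  destruct t as [n t|n F]; simpl; f_equal; [apply tm_subst_Var|].
  destruct (I_to_iota_surj F) as [B ->].
  rewrite <- I_to_iota_subst, (substI_ext B (@up_Var Sg n)), substI_Var; reflexivity.
Qed.

End Correspondence.

(** * Substitution of [ι]-terms *)

Section IotaSubstitution.
Context {Sg : signature}.

Ltac split_option H :=
  repeat match type of H with
  | context [option_bind _ ?o] => destruct o eqn:?; simpl in H; try discriminate H
  | context [option_map _ ?o] => destruct o eqn:?; simpl in H; try discriminate H
  | context [option_map2 _ ?o _] =>
      unfold option_map2 in H; destruct o eqn:?; simpl in H; try discriminate H
  end.

Lemma tm_isubst_simple n m (s : fin n -> option (tmD Sg m)) (r : fin n -> tm Sg m) t t' :
  (forall i u, s i = Some u -> u = TSim (r i)) ->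
  tm_isubst s t = Some t' -> t' = TSim (tm_subst r t).
Proof. intro E; destruct t; simpl; [apply E| |]; intros [= <-]; reflexivity. Qed.

Lemma vtraverse_simple n m (s : fin n -> option (tmD Sg m)) (r : fin n -> tm Sg m)
    k (v : Vector.t (tm Sg n) k) w :
  (forall i u, option_bind simple (s i) = Some u -> u = r i) ->
  vtraverse (fun t => option_bind simple (tm_isubst s t)) v = Some w ->
  w = Vector.map (tm_subst r) v.
Proof.
  intro E; revert w; induction v as [|t k v IH]; simpl; intros w H.
  - injection H as <-; reflexivity.
  - split_option H; injection H as <-; f_equal; auto.
    destruct t; simpl in *; [|congruence|congruence].
    apply E; assumption.
Qed.

Lemma iup_simple n m (s : fin n -> option (tmD Sg m)) (r : fin n -> tm Sg m) :
  (forall i u, s i = Some u -> u = TSim (r i)) ->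
  forall i u, iup s i = Some u -> u = TSim (up r i).
Proof.
  intros E [i|] u; simpl.
  - destruct (s i) eqn:Hi; simpl; [|discriminate].
    intros [= <-]; rewrite (E _ _ Hi); reflexivity.
  - intros [= <-]; reflexivity.
Qed.

Lemma simple_only_simple n m (s : fin n -> option (tmD Sg m)) (r : fin n -> tm Sg m) :
  (forall i u, option_bind simple (s i) = Some u -> u = r i) ->
  forall i u, simple_only s i = Some u -> u = TSim (r i).
Proof.
  intros E i u; unfold simple_only; specialize (E i).
  destruct (option_bind simple (s i)); simpl; [|discriminate].
  intros [= <-]; f_equal; auto.
Qed.

Lemma simple_weak n m (s : fin n -> option (tmD Sg m)) (r : fin n -> tm Sg m) :
  (forall i u, s i = Some u -> u = TSim (r i)) ->
  forall i u, option_bind simple (s i) = Some u -> u = r i.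
Proof.
  intros E i u; specialize (E i); destruct (s i) as [w|]; simpl; [|discriminate].
  rewrite (E w eq_refl); simpl; congruence.
Qed.

(** Agreement is asked only where [s] is defined, since below an [ι]-term [simple_only] makes
    undefined any variable that had an [ι]-term for value. This form therefore settles the bodies of
    nested [ι]-terms. *)
Lemma isubstD_simple n (A : formI Sg n) :
  forall m (s : fin n -> option (tmD Sg m)) (r : fin n -> tm Sg m) B,
    (forall i u, s i = Some u -> u = TSim (r i)) ->
    isubstD s (I_to_iota A) = Some B -> B = I_to_iota (substI r A).
Proof.
  induction A; intros m s1 r C E H; simpl in H |- *.
  - split_option H; injection H as <-; f_equal.
    eapply vtraverse_simple; [apply simple_weak, E|eassumption].
  - split_option H; injection H as <-; f_equal; eapply tm_isubst_simple; eassumption.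
  - destruct (tm_isubst s1 t) eqn:Ht; simpl in H; [|discriminate].
    destruct (tm_isubst s1 s) eqn:Hs; simpl in H; [|discriminate].
    rewrite (tm_isubst_simple E Ht), (tm_isubst_simple E Hs) in H; simpl in H; congruence.
  - congruence.
  - split_option H; injection H as <-; f_equal; eauto.
  - split_option H; injection H as <-; f_equal; eauto.
  - split_option H; injection H as <-; f_equal; eauto.
  - split_option H; injection H as <-; f_equal; eauto.
  - split_option H; injection H as <-; f_equal; eauto using iup_simple.
  - split_option H; injection H as <-; f_equal; eauto using iup_simple.
  - assert (E' := iup_simple (simple_only_simple (simple_weak E))).
    destruct G; simpl in H |- *.
    + destruct (isubstD _ _) eqn:HF; simpl in H; [|discriminate].
      injection H as <-; f_equal; f_equal; eauto.
    + destruct (isubstD _ _) eqn:HF; simpl in H; [|discriminate].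
      destruct (tm_isubst s1 t) eqn:Ht; simpl in H; [|discriminate].
      rewrite (tm_isubst_simple E Ht) in H; simpl in H.
      injection H as <-; f_equal; f_equal; eauto.
Qed.

Lemma tm_isubst_total n m (s : fin n -> option (tmD Sg m)) (r : fin n -> tm Sg m) t :
  (forall i, s i = Some (TSim (r i))) -> tm_isubst s t = Some (TSim (tm_subst r t)).
Proof. intro E; destruct t; simpl; auto. Qed.

Lemma iup_total n m (s : fin n -> option (tmD Sg m)) (r : fin n -> tm Sg m) :
  (forall i, s i = Some (TSim (r i))) -> forall i, iup s i = Some (TSim (up r i)).
Proof. intros E [i|]; simpl; [rewrite E|]; reflexivity. Qed.

(** With no [ι]-term among the values, none of the grammatical restrictions can fail. The ordinary
    quantifier rules are thus instances of those of [IPF^ιR]. *)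
Lemma isubstD_total n (A : formI Sg n) :
  forall m (s : fin n -> option (tmD Sg m)) (r : fin n -> tm Sg m),
    (forall i, s i = Some (TSim (r i))) ->
    isubstD s (I_to_iota A) = Some (I_to_iota (substI r A)).
Proof.
  induction A; intros m s1 r E; simpl;
    repeat match goal with
    | IH : forall m s r, _ -> isubstD s (I_to_iota ?A) = _ |- context [isubstD s1 (I_to_iota ?A)] =>
        rewrite (IH _ _ _ E)
    | IH : forall m s r, _ -> isubstD s (I_to_iota ?A) = _
      |- context [isubstD (iup s1) (I_to_iota ?A)] => rewrite (IH _ _ _ (iup_total E))
    | |- context [tm_isubst s1 ?t] => rewrite (tm_isubst_total t E); simpl
    end; try reflexivity.
  - assert (Hv : vtraverse (fun t => option_bind simple (tm_isubst s1 t)) v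
                 = Some (Vector.map (tm_subst r) v)).
    { induction v as [|t k v IH]; simpl; [reflexivity|].
      rewrite (tm_isubst_total t E), IH; reflexivity. }
    rewrite Hv; reflexivity.
  - assert (E' : forall i, simple_only s1 i = Some (TSim (r i)))
      by (intro i; unfold simple_only; rewrite E; reflexivity).
    destruct G; simpl; rewrite (IHA _ _ _ (iup_total E')); simpl; [reflexivity|].
    rewrite (tm_isubst_total t E); reflexivity.
Qed.

Lemma iinstD_simple (A : formI Sg 1) (t : tm Sg 0) :
  iinstD (I_to_iota A) (TSim t) = Some (I_to_iota (instI A t)).
Proof. apply isubstD_total; reflexivity. Qed.

(** * Commutation with ordinary substitution *)

Lemma tm_isubst_subst n m k (s : fin n -> option (tmD Sg m)) (r : fin m -> tm Sg k)
    (s' : fin n -> option (tmD Sg k)) t :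
  (forall i, s' i = option_map (tmD_subst r) (s i)) ->
  tm_isubst s' t = option_map (tmD_subst r) (tm_isubst s t).
Proof. intro E; destruct t; simpl; auto. Qed.

Lemma iup_subst n m k (s : fin n -> option (tmD Sg m)) (r : fin m -> tm Sg k)
    (s' : fin n -> option (tmD Sg k)) :
  (forall i, s' i = option_map (tmD_subst r) (s i)) ->
  forall i, iup s' i = option_map (tmD_subst (up r)) (iup s i).
Proof.
  intros E [i|]; simpl; [rewrite E|reflexivity].
  destruct (s i); simpl; [|reflexivity].
  rewrite !tmD_subst_comp; f_equal; apply tmD_subst_ext; reflexivity.
Qed.

Lemma simple_subst m k (r : fin m -> tm Sg k) (t : tmD Sg m) :
  simple (tmD_subst r t) = option_map (tm_subst r) (simple t).
Proof. destruct t; reflexivity. Qed.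

Lemma simple_only_subst n m k (s : fin n -> option (tmD Sg m)) (r : fin m -> tm Sg k)
    (s' : fin n -> option (tmD Sg k)) :
  (forall i, s' i = option_map (tmD_subst r) (s i)) ->
  forall i, simple_only s' i = option_map (tmD_subst r) (simple_only s i).
Proof.
  intros E i; unfold simple_only; rewrite E.
  destruct (s i) as [t|]; simpl; [rewrite simple_subst; destruct (simple t)|]; reflexivity.
Qed.

Lemma identity_subst m k (r : fin m -> tm Sg k) (t u : tmD Sg m) C :
  identity t u = Some C -> identity (tmD_subst r t) (tmD_subst r u) = Some (substD r C).
Proof.
  destruct t as [m t|m F]; simpl.
  - revert t; destruct u as [m u|m F]; simpl; intros t [= <-]; reflexivity.
  - revert F; destruct u as [m u|m F']; simpl; intros F; [intros [= <-]; reflexivity|discriminate].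
Qed.

(** The later substitution [r] introduces no [ι]-terms, so it turns no permitted position into a
    forbidden one. Its use is to instantiate a bound variable after an [ι]-term has been put in
    under the binder. *)
Lemma isubstD_subst n (A : formI Sg n) :
  forall m k (s : fin n -> option (tmD Sg m)) (r : fin m -> tm Sg k)
    (s' : fin n -> option (tmD Sg k)) B,
    (forall i, s' i = option_map (tmD_subst r) (s i)) ->
    isubstD s (I_to_iota A) = Some B ->
    isubstD s' (I_to_iota A) = Some (substD r B).
Proof.
  induction A; intros m k s1 r s' C E H; simpl in H |- *.
  - destruct (vtraverse _ _) as [w|] eqn:Hw in H; simpl in H; [|discriminate].
    injection H as <-.
    assert (Hv : vtraverse (fun t => option_bind simple (tm_isubst s' t)) v
                 = Some (Vector.map (tm_subst r) w)).
    { clear -E Hw; induction v as [|t l v IH]; simpl in *.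
      - injection Hw as <-; reflexivity.
      - rewrite (tm_isubst_subst t E).
        destruct (tm_isubst s1 t) as [u|]; simpl in *; [|discriminate].
        rewrite simple_subst; destruct (simple u); simpl in *; [|discriminate].
        destruct (vtraverse _ v) eqn:Hv in Hw; simpl in Hw; [|discriminate].
        injection Hw as <-; rewrite (IH _ Hv); reflexivity. }
    rewrite Hv; reflexivity.
  - rewrite (tm_isubst_subst t E).
    destruct (tm_isubst s1 t); simpl in *; [|discriminate].
    injection H as <-; reflexivity.
  - rewrite (tm_isubst_subst t E), (tm_isubst_subst s E).
    destruct (tm_isubst s1 t); simpl in *; [|discriminate].
    destruct (tm_isubst s1 s); simpl in *; [|discriminate].
    apply identity_subst, H.
  - injection H as <-; reflexivity.
  - split_option H; injection H as <-.
    erewrite IHA1, IHA2 by eassumption; reflexivity.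
  - split_option H; injection H as <-.
    erewrite IHA1, IHA2 by eassumption; reflexivity.
  - split_option H; injection H as <-.
    erewrite IHA1, IHA2 by eassumption; reflexivity.
  - split_option H; injection H as <-.
    erewrite IHA1, IHA2 by eassumption; reflexivity.
  - split_option H; injection H as <-.
    erewrite IHA by (eauto using iup_subst); reflexivity.
  - split_option H; injection H as <-.
    erewrite IHA by (eauto using iup_subst); reflexivity.
  - assert (E' := iup_subst (simple_only_subst E)).
    destruct G; simpl in H |- *.
    + destruct (isubstD _ _) eqn:HF in H; simpl in H; [|discriminate].
      injection H as <-; erewrite IHA by eassumption; reflexivity.
    + destruct (isubstD _ _) eqn:HF in H; simpl in H; [|discriminate].
      erewrite IHA by eassumption; rewrite (tm_isubst_subst t E).
      destruct (tm_isubst s1 t) as [u|]; simpl in H |- *; [|discriminate].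
      apply (identity_subst r (t := TIota f) H).
Qed.

End IotaSubstitution.

(** * Derivability *)

Lemma derives_cut (form : Type) (R : list (sequent form) -> sequent form -> Prop)
    (H H' : sequent form -> Prop) s :
  (forall q, H q -> derives R H' q) -> derives R H s -> derives R H' s.
Proof.
  intros HH D; induction D; [auto|apply d_assume|eapply d_weaken|eapply d_rule];
    eassumption.
Qed.

Lemma derives_map (f g : Type) (R : list (sequent f) -> sequent f -> Prop)
    (R' : list (sequent g) -> sequent g -> Prop) (tr : f -> g) :
  (forall ps s, R ps s ->
     derives R' (fun q => In q (map (map_sequent tr) ps)) (map_sequent tr s)) ->
  forall s, derives R (fun _ => False) s -> derives R' (fun _ => False) (map_sequent tr s).
Proof.
  intros HR; induction 1 as [s []|G A HA|G D A HG _ IH|ps s Hr _ IH].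
  - apply d_assume, in_map, HA.
  - refine (d_weaken _ IH); apply incl_map, HG.
  - refine (derives_cut _ (HR _ _ Hr)).
    intros q Hq; apply in_map_iff in Hq as [p [<- Hp]]; auto.
Qed.

(** The converse carries a derivation along [back]; the cancellation law returns its conclusion to
    [A] and its assumptions to [T]. *)
Lemma derivable_iff (f g : Type) (R : list (sequent f) -> sequent f -> Prop)
    (R' : list (sequent g) -> sequent g -> Prop) (tr : f -> g) (back : g -> f) :
  (forall ps s, R ps s ->
     derives R' (fun q => In q (map (map_sequent tr) ps)) (map_sequent tr s)) ->
  (forall ps s, R' ps s ->
     derives R (fun q => In q (map (map_sequent back) ps)) (map_sequent back s)) ->
  (forall A, back (tr A) = A) ->
  forall T A, derivable R T A <-> derivable R' (image tr T) (tr A).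
Proof.
  intros HR HR' K T A; split; intros [G [HG D]].
  - exists (map tr G); split; [|exact (derives_map HR D)].
    intros B HB; apply in_map_iff in HB as [C [<- HC]]; exists C; auto.
  - exists (map back G); split.
    + intros B HB; apply in_map_iff in HB as [C [<- HC]].
      destruct (HG _ HC) as [C' HC' ->]; rewrite K; exact HC'.
    + rewrite <- (K A); exact (derives_map HR' D).
Qed.

(** * Intuitionist positive free logic *)

Section FreeLogic.
Context {Sg : signature}.

(* The rules shared by the two systems; [formI] serves as notation for both. *)
Record IPF_closed (P : list (formI Sg 0) -> formI Sg 0 -> Prop) : Prop := {
  assume G A : In A G -> P G A;
  weaken G D A : incl G D -> P G A -> P D A;
  andI G A B : P G A -> P G B -> P G (IAnd A B);
  andE1 G A B : P G (IAnd A B) -> P G A;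
  andE2 G A B : P G (IAnd A B) -> P G B;
  impI G A B : P (A :: G) B -> P G (IImp A B);
  impE G A B : P G (IImp A B) -> P G A -> P G B;
  orI1 G A B : P G A -> P G (IOr A B);
  orI2 G A B : P G B -> P G (IOr A B);
  orE G A B C : P G (IOr A B) -> P (A :: G) C -> P (B :: G) C -> P G C;
  iffI G A B : P (A :: G) B -> P (B :: G) A -> P G (IIff A B);
  iffE1 G A B : P G (IIff A B) -> P G A -> P G B;
  iffE2 G A B : P G (IIff A B) -> P G B -> P G A;
  botE G A : atomicI A -> P G IBot -> P G A;
  allI G A a : fresh_ctxI a G -> ~ occursI a A ->
    P (IExt (Par a) :: G) (instI A (Par a)) -> P G (IAll A);
  allE G A t : P G (IAll A) -> P G (IExt t) -> P G (instI A t);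
  exI G A t : P G (instI A t) -> P G (IExt t) -> P G (IEx A);
  exE G A C a : fresh_ctxI a G -> ~ occursI a A -> ~ occursI a C ->
    P G (IEx A) -> P (instI A (Par a) :: IExt (Par a) :: G) C -> P G C;
  eqI G t : P G (IEq t t);
  eqE G A t u : atomicI A -> P G (IEq t u) -> P G (instI A t) -> P G (instI A u)
}.

(** * Fresh parameters *)

Lemma occursI_bounded n (A : formI Sg n) : exists N, forall a, occursI a A -> a < N.
Proof.
  assert (Ht : forall m (t : tm Sg m), exists N, forall a, t = Par a -> a < N).
  { intros m [i|c|b]; [exists 0|exists 0|exists (S b)]; intros a E; try discriminate.
    injection E as ->; lia. }
  induction A; simpl.
  - induction v as [|t k v [N IH]].
    + exists 0; intros a Ha; inversion Ha.
    + destruct (Ht _ t) as [M HM]; exists (N + M); intros a Ha.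
      apply Vector.In_cons_iff in Ha as [E|E]; [apply HM in E|apply IH in E]; lia.
  - apply Ht.
  - destruct (Ht _ t) as [N HN], (Ht _ s) as [M HM]; exists (N + M).
    intros a [E|E]; [apply HN in E|apply HM in E]; lia.
  - exists 0; tauto.
  - destruct IHA1 as [N HN], IHA2 as [M HM]; exists (N + M).
    intros a [E|E]; [apply HN in E|apply HM in E]; lia.
  - destruct IHA1 as [N HN], IHA2 as [M HM]; exists (N + M).
    intros a [E|E]; [apply HN in E|apply HM in E]; lia.
  - destruct IHA1 as [N HN], IHA2 as [M HM]; exists (N + M).
    intros a [E|E]; [apply HN in E|apply HM in E]; lia.
  - destruct IHA1 as [N HN], IHA2 as [M HM]; exists (N + M).
    intros a [E|E]; [apply HN in E|apply HM in E]; lia.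
  - exact IHA.
  - exact IHA.
  - destruct IHA as [N HN]; destruct G as [|t].
    + exists N; simpl; intros a [E|[]]; auto.
    + destruct (Ht _ t) as [M HM]; exists (N + M); simpl.
      intros a [E|E]; [apply HN in E|apply HM in E]; lia.
Qed.

(** To avoid further expressions, put them in the list: [IAll F] stands for a formula [F] with a
    free variable and [IExt t] for a term, since [occursI] reduces there to occurrence in [F] and in
    [t]. *)
Lemma fresh_exists (G : list (formI Sg 0)) : exists a, fresh_ctxI a G.
Proof.
  enough (exists N, forall a, N <= a -> fresh_ctxI a G) as [N HN] by eauto.
  induction G as [|A G [N IH]].
  - exists 0; intros a _ B [].
  - destruct (occursI_bounded A) as [M HM]; exists (N + M); intros a Ha B [<-|HB].
    + intro E; apply HM in E; lia.
    + apply (IH a); [lia|exact HB].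
Qed.

Lemma fresh_cons a (A : formI Sg 0) G :
  fresh_ctxI a (A :: G) -> ~ occursI a A /\ fresh_ctxI a G.
Proof. intro H; split; [|intros B HB]; apply H; simpl; auto. Qed.

(** The subdeduction of [a = t] from [F^x_a] and [∃!a] in [I_theI] and [I_theE1], internalised as a
    formula so that it can be weakened and instantiated without renaming. *)
Definition unique (F : formI Sg 1) (t : tm Sg 0) : formI Sg 0 :=
  IAll (IImp F (IEq var0 (tm_shift t))).

Lemma tm_shift_Par n (t : tm Sg n) a : tm_shift t = Par a -> t = Par a.
Proof. destruct t; intro H; [discriminate H|discriminate H|injection H as ->; reflexivity]. Qed.

Context (P : list (formI Sg 0) -> formI Sg 0 -> Prop) (HP : IPF_closed P).

(** * Identity and Leibniz's Law for all formulas *)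

Lemma weaken_cons G A B : P G A -> P (B :: G) A.
Proof. apply (weaken HP), incl_tl, incl_refl. Qed.

Lemma assume_hd G A : P (A :: G) A.
Proof. apply (assume HP); simpl; auto. Qed.

Lemma eq_sym G t u : P G (IEq t u) -> P G (IEq u t).
Proof.
  intro E.
  assert (H := eqE HP (A := IEq var0 (tm_shift t)) I E).
  unfold instI in H; simpl in H; rewrite !tm_shift_inst in H; apply H, (eqI HP).
Qed.

Lemma eq_trans G t u v : P G (IEq t u) -> P G (IEq u v) -> P G (IEq t v).
Proof.
  intros E1 E2.
  assert (H := eqE HP (A := IEq (tm_shift t) var0) I E2).
  unfold instI in H; simpl in H; rewrite !tm_shift_inst in H; apply H, E1.
Qed.

(** Induction on [A], where [r] reduces its free variables to the one being replaced, so that the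
    bodies of quantifiers are covered. Implication and biconditional use the hypothesis also for
    [u = t], hence the generality in [t] and [u]. *)
Lemma leibniz_subst n (A : formI Sg n) : forall (r : fin n -> tm Sg 1) G t u,
  P G (IEq t u) -> P G (instI (substI r A) t) -> P G (instI (substI r A) u).
Proof.
  induction A; intros r D x y E H;
    try (eapply (eqE HP) with (t := x); [exact I|exact E|exact H]).
  - exact H.
  - apply (andI HP); [eapply IHA1|eapply IHA2]; try exact E;
      [exact (andE1 HP H)|exact (andE2 HP H)].
  - refine (orE HP H _ _); [apply (orI1 HP); eapply IHA1|apply (orI2 HP); eapply IHA2];
      eauto using weaken_cons, assume_hd.
  - apply (impI HP); eapply IHA2; [apply weaken_cons, E|].
    refine (impE HP (weaken_cons _ H) _).
    eapply IHA1; [apply weaken_cons, eq_sym, E|apply assume_hd].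
  - apply (iffI HP).
    + eapply IHA2; [apply weaken_cons, E|].
      refine (iffE1 HP (weaken_cons _ H) _).
      eapply IHA1; [apply weaken_cons, eq_sym, E|apply assume_hd].
    + eapply IHA1; [apply weaken_cons, E|].
      refine (iffE2 HP (weaken_cons _ H) _).
      eapply IHA2; [apply weaken_cons, eq_sym, E|apply assume_hd].
  - destruct (fresh_exists (instI (substI r (IAll A)) y :: D)) as [b Hb].
    apply fresh_cons in Hb as [Hb HD].
    apply (allI HP HD Hb); rewrite instI_up_subst.
    eapply IHA; [apply weaken_cons, E|].
    rewrite <- instI_up_subst; apply (allE HP); [apply weaken_cons, H|apply assume_hd].
  - destruct (fresh_exists (instI (substI r (IEx A)) x :: instI (substI r (IEx A)) y :: D))
      as [b Hb].
    apply fresh_cons in Hb as [Hx Hb]; apply fresh_cons in Hb as [Hy HD].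
    refine (exE HP HD Hx Hy H _).
    change (P (instI (substI (up (fun _ => x)) (substI (up r) A)) (Par b) :: IExt (Par b) :: D)
      (IEx (substI (up (fun _ => y)) (substI (up r) A)))).
    apply (exI HP) with (t := Par b); [|apply weaken_cons, assume_hd].
    rewrite !instI_up_subst; eapply IHA; [do 2 apply weaken_cons; exact E|apply assume_hd].
Qed.

Lemma leibniz (A : formI Sg 1) G t u :
  P G (IEq t u) -> P G (instI A t) -> P G (instI A u).
Proof. rewrite <- (substI_Var A); apply leibniz_subst. Qed.

Lemma uniqueI G F t a :
  fresh_ctxI a G -> ~ occursI a F -> t <> Par a ->
  P (instI F (Par a) :: IExt (Par a) :: G) (IEq (Par a) t) -> P G (unique F t).
Proof.
  intros HG HF Ht H; apply (allI HP) with (a := a); [exact HG| |].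
  - simpl; intros [H'|[H'|H']]; [tauto|discriminate|apply Ht, tm_shift_Par, H'].
  - unfold instI; simpl; rewrite tm_shift_inst; apply (impI HP), H.
Qed.

Lemma uniqueE G F t u :
  P G (unique F t) -> P G (IExt u) -> P G (instI F u) -> P G (IEq u t).
Proof.
  intros H Hu HF; assert (H' := allE HP H Hu).
  unfold instI in H'; simpl in H'; rewrite tm_shift_inst in H'; exact (impE HP H' HF).
Qed.

(** The right side of Lambert's Law at [t] for [y]. *)
Definition exactly (F : formI Sg 1) (t : tm Sg 0) : formI Sg 0 :=
  IAll (IIff F (IEq var0 (tm_shift t))).

(** Left to right is [unique]; right to left is Leibniz's Law for the arbitrary formula [F]. *)
Lemma exactlyI G F t : P G (instI F t) -> P G (unique F t) -> P G (exactly F t).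
Proof.
  intros HF HU; destruct (fresh_exists (exactly F t :: G)) as [b Hb].
  apply fresh_cons in Hb as [Hb HG]; apply (allI HP HG); [exact Hb|].
  unfold instI at 1; simpl; rewrite tm_shift_inst; apply (iffI HP).
  - apply (uniqueE (F := F)); [do 2 apply weaken_cons; exact HU| |apply assume_hd].
    apply weaken_cons, assume_hd.
  - apply leibniz with (t := t); [apply eq_sym, assume_hd|do 2 apply weaken_cons; exact HF].
Qed.

Lemma exactly_inst G F t : P G (IExt t) -> P G (exactly F t) -> P G (instI F t).
Proof.
  intros Ht H; assert (H' := allE HP H Ht).
  unfold instI in H'; simpl in H'; rewrite tm_shift_inst in H'.
  exact (iffE2 HP H' (eqI HP _ _)).
Qed.

Lemma exactly_unique G F t : P G (exactly F t) -> P G (unique F t).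
Proof.
  intro H; destruct (fresh_exists (exactly F t :: G)) as [b Hb].
  apply fresh_cons in Hb as [Hb HG]; apply (allI HP HG); [exact Hb|].
  assert (H' := allE HP (weaken_cons (IExt (Par b)) H) (assume_hd _ _)).
  unfold instI in H' |- *; simpl in H' |- *; rewrite tm_shift_inst in H' |- *.
  apply (impI HP); exact (iffE1 HP (weaken_cons _ H') (assume_hd _ _)).
Qed.

End FreeLogic.

(** * [ι]-terms in the system with [Ix[F,G]] *)

Section FromI.
Context {Sg : signature} (H : sequent (formI Sg 0) -> Prop).

Definition entailsI (G : list (formI Sg 0)) (A : formI Sg 0) : Prop :=
  derives (@IPF_IR Sg) H (G, A).

Ltac by_rule r :=
  intros; eapply d_rule;
  [eapply r; eassumption
  |let p := fresh in let Hp := fresh in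
   intros p Hp; simpl in Hp; repeat (destruct Hp as [<-|Hp]; [eassumption|]); destruct Hp].

Lemma entailsI_closed : IPF_closed entailsI.
Proof.
  unfold entailsI; split.
  - intros; apply d_assume; assumption.
  - intros; eapply d_weaken; eassumption.
  - by_rule I_andI.
  - by_rule I_andE1.
  - by_rule I_andE2.
  - by_rule I_impI.
  - by_rule I_impE.
  - by_rule I_orI1.
  - by_rule I_orI2.
  - by_rule I_orE.
  - by_rule I_iffI.
  - by_rule I_iffE1.
  - by_rule I_iffE2.
  - by_rule I_botE.
  - by_rule I_allI.
  - by_rule I_allE.
  - by_rule I_exI.
  - by_rule I_exE.
  - by_rule I_eqI.
  - intros G A t u HA E HA'; apply d_rule with (1 := I_eqE G t u HA).
    intros p [<-|[<-|[]]]; assumption.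
Qed.

Local Notation HP := entailsI_closed.

Lemma theI G F (K : scope Sg 0) t :
  entailsI G (instI F t) -> entailsI G (instI (scope_form K) t) -> entailsI G (IExt t) ->
  entailsI G (unique F t) -> entailsI G (IThe F K).
Proof.
  intros HF HK Ht HU; destruct (fresh_exists (IExt t :: IAll F :: G)) as [a Ha].
  apply fresh_cons in Ha as [Ha1 Ha]; apply fresh_cons in Ha as [Ha2 HG].
  apply d_rule with (1 := I_theI K HG Ha2 Ha1).
  intros p [<-|[<-|[<-|[<-|[]]]]]; try assumption.
  apply (uniqueE HP (F := F)); [do 2 apply (weaken_cons HP); exact HU| |apply (assume_hd HP)].
  apply (weaken_cons HP), (assume_hd HP).
Qed.

(** [IE1p] with [t = u] for [C]: its parameter [b] has [F^x_b] and [b = u], and uniqueness gives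
    [b = t]. A single fresh parameter serves for both subdeductions. *)
Lemma theEq_value G F t u :
  entailsI G (IThe F (ScEq u)) -> entailsI G (instI F t) -> entailsI G (IExt t) ->
  entailsI G (unique F t) -> entailsI G (IEq t u).
Proof.
  intros HI HF Ht HU; destruct (fresh_exists (IEq t u :: IAll F :: G)) as [a Ha].
  apply fresh_cons in Ha as [Ha1 Ha]; apply fresh_cons in Ha as [Ha2 HG].
  assert (Hta : t <> Par a) by (simpl in Ha1; tauto).
  assert (Hua : ~ occurs_scope a (ScEq u)) by (simpl in Ha1 |- *; tauto).
  apply d_rule with (1 := I_theE1 HG Ha2 Hta HG Ha2 Hua Ha1).
  intros p [<-|[<-|[<-|[<-|[<-|[]]]]]]; try assumption.
  - apply (uniqueE HP (F := F)); [do 2 apply (weaken_cons HP); exact HU| |apply (assume_hd HP)].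
    apply (weaken_cons HP), (assume_hd HP).
  - apply (eq_trans HP) with (u := Par a).
    + apply (eq_sym HP), (uniqueE HP (F := F));
        [do 3 apply (weaken_cons HP); exact HU| |apply (assume_hd HP)].
      apply (assume HP); simpl; auto.
    + unfold instI at 2; simpl; rewrite tm_shift_inst.
      apply (weaken_cons HP), (assume_hd HP).
Qed.

(* An existing [ιxF] may be replaced by a fresh parameter: this is what makes the
   quantifier rules for [ι]-terms derivable. *)
Lemma theEx_elim G F C :
  entailsI G (IThe F ScEx) ->
  (forall a D, incl G D -> entailsI D (instI F (Par a)) -> entailsI D (IExt (Par a)) ->
     entailsI D (unique F (Par a)) -> entailsI D C) ->
  entailsI G C.
Proof.
  intros HI HC; destruct (fresh_exists (C :: IAll F :: G)) as [a Ha].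
  apply fresh_cons in Ha as [Ha1 Ha]; apply fresh_cons in Ha as [Ha2 HG].
  apply d_rule with (1 := I_theE3 HG Ha2 Ha1).
  intros p [<-|[<-|[]]]; [exact HI|].
  apply HC with (a := a).
  - do 2 apply incl_tl; apply incl_refl.
  - apply (assume_hd HP).
  - apply (weaken_cons HP), (assume_hd HP).
  - destruct (fresh_exists (IAll F :: IExt (Par a) :: instI F (Par a) :: IExt (Par a) :: G))
      as [b Hb].
    apply fresh_cons in Hb as [Hb1 Hb]; apply fresh_cons in Hb as [Hb2 Hb3].
    apply (uniqueI HP Hb3 Hb1 Hb2).
    (* [IE2p] with [x = a] for [A] carries [a = a] to [b = a]. *)
    assert (HA : atomicI (IEq var0 (tm_shift (Par a : tm Sg 0)))) by exact I.
    apply d_rule with (1 := I_theE2 _ F (Par a) (Par b) HA).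
    intros p [<-|[<-|[<-|[<-|[<-|[<-|[]]]]]]].
    + do 4 apply (weaken_cons HP); exact HI.
    + apply (assume HP); simpl; auto.
    + apply (assume HP); simpl; auto.
    + apply (assume HP); simpl; auto.
    + apply (assume HP); simpl; auto.
    + apply (eqI HP).
Qed.

(** For any existing [b] that is F, [IE4p] with [b = x] for [A] carries [b = b] to [b = t]. *)
Lemma theEq_unique G F t :
  entailsI G (IThe F (ScEq t)) -> entailsI G (IExt t) -> entailsI G (unique F t).
Proof.
  intros HI Ht; destruct (fresh_exists (IAll F :: IExt t :: G)) as [b Hb].
  apply fresh_cons in Hb as [Hb1 Hb]; apply fresh_cons in Hb as [Hb2 HG].
  apply (uniqueI HP HG Hb1 Hb2).
  assert (HA : atomicI (IEq (tm_shift (Par b : tm Sg 0)) var0)) by exact I.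
  apply d_rule with (1 := I_theE4 _ F (Par b) t HA).
  intros p [<-|[<-|[<-|[<-|[<-|[]]]]]].
  - do 2 apply (weaken_cons HP); exact HI.
  - apply (weaken_cons HP), (assume_hd HP).
  - do 2 apply (weaken_cons HP); exact Ht.
  - apply (assume_hd HP).
  - apply (eqI HP).
Qed.

(** [IE5p] supplies a parameter that is F; uniqueness equates it with [t], and Leibniz's Law moves
    the whole formula [F] across. *)
Lemma theEq_inst G F t :
  entailsI G (IThe F (ScEq t)) -> entailsI G (IExt t) -> entailsI G (instI F t).
Proof.
  intros HI Ht; destruct (fresh_exists (instI F t :: IAll F :: IExt t :: G)) as [a Ha].
  apply fresh_cons in Ha as [Ha1 Ha]; apply fresh_cons in Ha as [Ha2 Ha].
  apply fresh_cons in Ha as [Ha3 HG].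
  apply d_rule with (1 := I_theE5 HG Ha2 Ha3 Ha1).
  intros p [<-|[<-|[<-|[]]]]; [exact HI|exact Ht|].
  apply (leibniz HP) with (t := Par a); [|apply (assume_hd HP)].
  apply (uniqueE HP (F := F)); [|apply (weaken_cons HP), (assume_hd HP)|apply (assume_hd HP)].
  do 2 apply (weaken_cons HP); apply theEq_unique; assumption.
Qed.

(** Left to right is [II], right to left [IE1p]. This is the identity case of the replacement of [t]
    by [ιxF]. *)
Lemma theEq_iff G F t u :
  entailsI G (instI F t) -> entailsI G (IExt t) -> entailsI G (unique F t) ->
  entailsI G (IEq t u) <-> entailsI G (IThe F (ScEq u)).
Proof.
  intros HF Ht HU; split.
  - intro E; apply theI with (t := t); try assumption.
    unfold instI; simpl; rewrite tm_shift_inst; exact E.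
  - intro HI; apply theEq_value with (F := F); assumption.
Qed.

Lemma theEq_trans G F t u :
  entailsI G (IThe F (ScEq t)) -> entailsI G (IEq t u) -> entailsI G (IThe F (ScEq u)).
Proof.
  intros HI E.
  assert (H' := leibniz HP (A := IThe (substI (up shift_var) F) (ScEq var0)) E).
  unfold instI in H'; simpl in H'; rewrite !substI_shift_inst in H'; exact (H' HI).
Qed.

Lemma Lambert_derivable G (F : formD Sg 2) : entailsI G (iota_to_I (Lambert F)).
Proof.
  simpl; set (F' := iota_to_I F).
  match goal with |- entailsI _ (IAll ?B) => destruct (fresh_exists (IAll B :: G)) as [a Ha] end.
  apply fresh_cons in Ha as [Ha HG]; apply (allI HP HG); [exact Ha|].
  (* [F] may contain [y]; at the parameter [a] it becomes [F1], and the right side of Lambert's Law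
     computes to [exactly F1 (Par a)]. *)
  set (F1 := substI (up (fun _ : fin 1 => (Par a : tm Sg 0))) F').
  change (entailsI (IExt (Par a) :: G) (IIff (IThe F1 (ScEq (Par a))) (exactly F1 (Par a)))).
  apply (iffI HP).
  - apply (exactlyI HP); [apply theEq_inst|apply theEq_unique];
      try apply (assume_hd HP); apply (weaken_cons HP), (assume_hd HP).
  - assert (Ht : entailsI (exactly F1 (Par a) :: IExt (Par a) :: G) (IExt (Par a)))
      by apply (weaken_cons HP), (assume_hd HP).
    apply theI with (t := Par a).
    + apply (exactly_inst HP); [exact Ht|apply (assume_hd HP)].
    + apply (eqI HP).
    + exact Ht.
    + apply (exactly_unique HP), (assume_hd HP).
Qed.

(** * Replacement of [t0] by [ιxF] *)

Section Replacement.
Context (F : formI Sg 1) (t0 : tm Sg 0).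

(* [s] and [r] differ only in that [s] may have [ιxF] where [r] has [t0]. *)
Let related n (s : fin n -> option (tmD Sg 0)) (r : fin n -> tm Sg 0) : Prop :=
  forall i, s i = Some (TSim (r i)) \/ s i = Some (TIota (I_to_iota F)) /\ r i = t0.

Lemma related_simple n (s : fin n -> option (tmD Sg 0)) r :
  related s r -> forall i u, option_bind simple (s i) = Some u -> u = r i.
Proof.
  intros E i u; destruct (E i) as [->|[-> _]]; simpl; [congruence|discriminate].
Qed.

Lemma tm_isubst_related n (s : fin n -> option (tmD Sg 0)) r t :
  related s r ->
  tm_isubst s t = Some (TSim (tm_subst r t)) \/
  tm_isubst s t = Some (TIota (I_to_iota F)) /\ tm_subst r t = t0.
Proof. intro E; destruct t; simpl; auto. Qed.

Lemma isubstD_scons n (A : formI Sg (S n)) (s : fin n -> option (tmD Sg 0)) B (b : tm Sg 0) :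
  isubstD (iup s) (I_to_iota A) = Some B ->
  isubstD (fun i : fin (S n) => match i with None => Some (TSim b) | Some j => s j end)
    (I_to_iota A) = Some (instD B b).
Proof.
  intro HB; refine (isubstD_subst _ HB).
  intros [i|]; simpl; [|reflexivity].
  destruct (s i); simpl; [|reflexivity].
  rewrite tmD_subst_comp, (tmD_subst_ext (s' := @Var Sg 0)), tmD_subst_Var; [reflexivity|].
  intros [].
Qed.

Lemma related_scons n (s : fin n -> option (tmD Sg 0)) r (b : tm Sg 0) :
  related s r ->
  related (fun i : fin (S n) => match i with None => Some (TSim b) | Some j => s j end)
    (scons b r).
Proof. intros E [i|]; simpl; [apply E|auto]. Qed.

(** The conditions on [t0] make it the value of an existing [ιxF], so the two terms agree on
    existence and on identities, the only places where the grammar lets [ιxF] in. The context is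
    general because implications and quantifiers extend it. *)
Lemma isubstD_iff n (A : formI Sg n) : forall (s : fin n -> option (tmD Sg 0)) r B G,
  related s r -> isubstD s (I_to_iota A) = Some B ->
  entailsI G (instI F t0) -> entailsI G (IExt t0) -> entailsI G (unique F t0) ->
  entailsI G (substI r A) <-> entailsI G (iota_to_I B).
Proof.
  assert (Hweak := weaken_cons HP); assert (Hhd := assume_hd HP).
  induction A; intros s1 r C D E HB HF Ht HU; simpl in HB.
  - destruct (vtraverse _ _) as [w|] eqn:Hw; simpl in HB; [|discriminate].
    injection HB as <-; rewrite (vtraverse_simple (related_simple E) Hw); tauto.
  - destruct (tm_isubst_related t E) as [Hs|[Hs Hr]]; rewrite Hs in HB;
      injection HB as <-; simpl; [tauto|].
    rewrite Hr, I_to_iotaK; split; intros _; [|exact Ht].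
    apply theI with (t := t0); assumption.
  - destruct (tm_isubst_related t E) as [Hs|[Hs Hr]]; rewrite Hs in HB; simpl in HB;
    destruct (tm_isubst_related s E) as [Hs'|[Hs' Hr']]; rewrite Hs' in HB; simpl in HB;
      try discriminate; injection HB as <-; simpl; rewrite ?I_to_iotaK.
    + tauto.
    (* [identity] writes the [ι]-term on the left, so the sides change places. *)
    + rewrite Hr', <- (theEq_iff _ HF Ht HU); split; apply (eq_sym HP).
    + rewrite Hr; apply theEq_iff; assumption.
  - injection HB as <-; tauto.
  - unfold option_map2 in HB.
    destruct (isubstD s1 (I_to_iota A1)) as [B1|] eqn:H1; simpl in HB; [|discriminate].
    destruct (isubstD s1 (I_to_iota A2)) as [B2|] eqn:H2; simpl in HB; [|discriminate].
    injection HB as <-; specialize (IHA1 _ _ _ D E H1 HF Ht HU).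
    specialize (IHA2 _ _ _ D E H2 HF Ht HU); simpl; split; intro HA; apply (andI HP);
      (apply IHA1 || apply IHA2); (exact (andE1 HP HA) || exact (andE2 HP HA)).
  - unfold option_map2 in HB.
    destruct (isubstD s1 (I_to_iota A1)) as [B1|] eqn:H1; simpl in HB; [|discriminate].
    destruct (isubstD s1 (I_to_iota A2)) as [B2|] eqn:H2; simpl in HB; [|discriminate].
    injection HB as <-; simpl; split; intro HA; (refine (orE HP HA _ _);
      [apply (orI1 HP); eapply IHA1|apply (orI2 HP); eapply IHA2]);
      eauto.
  - unfold option_map2 in HB.
    destruct (isubstD s1 (I_to_iota A1)) as [B1|] eqn:H1; simpl in HB; [|discriminate].
    destruct (isubstD s1 (I_to_iota A2)) as [B2|] eqn:H2; simpl in HB; [|discriminate].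
    injection HB as <-; simpl; split; intro HA; apply (impI HP);
      (eapply IHA2; eauto);
      (refine (impE HP (weaken_cons HP _ HA) _));
      (eapply IHA1; eauto).
  - unfold option_map2 in HB.
    destruct (isubstD s1 (I_to_iota A1)) as [B1|] eqn:H1; simpl in HB; [|discriminate].
    destruct (isubstD s1 (I_to_iota A2)) as [B2|] eqn:H2; simpl in HB; [|discriminate].
    injection HB as <-; simpl; split; intro HA; apply (iffI HP).
    1, 3: (eapply IHA2; eauto);
      (refine (iffE1 HP (weaken_cons HP _ HA) _));
      (eapply IHA1; eauto).
    all: (eapply IHA1; eauto);
      (refine (iffE2 HP (weaken_cons HP _ HA) _));
      (eapply IHA2; eauto).
  - destruct (isubstD (iup s1) (I_to_iota A)) as [B1|] eqn:H1; simpl in HB; [|discriminate].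
    injection HB as <-; simpl.
    (* Extending both substitutions by [b] keeps them related, so the induction hypothesis reaches
       the instances of the two bodies. *)
    assert (IH : forall b G, incl D G -> entailsI G (instI (substI (up r) A) b) <->
                                         entailsI G (instI (iota_to_I B1) b)).
    { intros b G HG; rewrite <- iota_to_I_inst, instI_up.
      apply IHA with (1 := related_scons b E); [apply isubstD_scons, H1|..];
        apply (weaken HP HG); assumption. }
    destruct (fresh_exists (IAll (substI (up r) A) :: IAll (iota_to_I B1) :: D)) as [b Hb].
    apply fresh_cons in Hb as [Hb1 Hb]; apply fresh_cons in Hb as [Hb2 HD].
    split; intro HA; (apply (allI HP HD); [assumption|]); apply IH;
      try (apply incl_tl, incl_refl);
      (apply (allE HP); [apply (weaken_cons HP), HA|apply (assume_hd HP)]).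
  - destruct (isubstD (iup s1) (I_to_iota A)) as [B1|] eqn:H1; simpl in HB; [|discriminate].
    injection HB as <-; simpl.
    assert (IH : forall b G, incl D G -> entailsI G (instI (substI (up r) A) b) <->
                                         entailsI G (instI (iota_to_I B1) b)).
    { intros b G HG; rewrite <- iota_to_I_inst, instI_up.
      apply IHA with (1 := related_scons b E); [apply isubstD_scons, H1|..];
        apply (weaken HP HG); assumption. }
    destruct (fresh_exists (IAll (substI (up r) A) :: IAll (iota_to_I B1) :: D)) as [b Hb].
    apply fresh_cons in Hb as [Hb1 Hb]; apply fresh_cons in Hb as [Hb2 HD].
    split; intro HA; (refine (exE HP HD _ _ HA _); [assumption|assumption|]);
      (apply (exI HP) with (t := Par b); [|apply (weaken_cons HP), (assume_hd HP)]);
      (apply IH; [do 2 apply incl_tl; apply incl_refl|apply (assume_hd HP)]).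
  (* [ιxF] cannot enter the body of another [ι]-term, so the two sides have literally the same
     body. *)
  - assert (E' := iup_simple (simple_only_simple (related_simple E))).
    destruct G as [|t]; simpl in HB;
      destruct (isubstD _ _) as [B1|] eqn:H1; simpl in HB; try discriminate;
      apply (isubstD_simple E') in H1; subst B1.
    + injection HB as <-; simpl; rewrite I_to_iotaK; tauto.
    + destruct (tm_isubst_related t E) as [Hs|[Hs Hr]]; rewrite Hs in HB; simpl in HB;
        [|discriminate].
      injection HB as <-; simpl; rewrite I_to_iotaK; tauto.
Qed.

(** Here only [ιxF = t0] is given, and [t0] may fail to exist. In an atomic formula existence
    matters only for [∃!], where the premiss [∃!t0] itself supplies it; identities follow by
    [theEq_trans]. *)
Lemma isubstD_eqE n (A : formI Sg n) (s : fin n -> option (tmD Sg 0)) r B G :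
  related s r -> atomicI A -> isubstD s (I_to_iota A) = Some B ->
  entailsI G (IThe F (ScEq t0)) -> entailsI G (substI r A) -> entailsI G (iota_to_I B).
Proof.
  intros E HA HB HI; destruct A as [n p v|n t|n t u| | | | | | | |n F' K]; try destruct HA;
    simpl in HB |- *.
  - destruct (vtraverse _ _) as [w|] eqn:Hw; simpl in HB; [|discriminate].
    injection HB as <-; rewrite (vtraverse_simple (related_simple E) Hw); tauto.
  - destruct (tm_isubst_related t E) as [Hs|[Hs Hr]]; rewrite Hs in HB;
      injection HB as <-; simpl; [tauto|].
    rewrite Hr, I_to_iotaK; intro Ht.
    apply theI with (t := t0); auto using theEq_inst, theEq_unique.
  - destruct (tm_isubst_related t E) as [Hs|[Hs Hr]]; rewrite Hs in HB; simpl in HB;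
    destruct (tm_isubst_related u E) as [Hs'|[Hs' Hr']]; rewrite Hs' in HB; simpl in HB;
      try discriminate; injection HB as <-; simpl; rewrite ?I_to_iotaK.
    + tauto.
    + rewrite Hr'; intro Ht; apply theEq_trans with (t := t0); [exact HI|].
      apply (eq_sym HP), Ht.
    + rewrite Hr; apply theEq_trans, HI.
  - assert (E' := iup_simple (simple_only_simple (related_simple E))).
    destruct K as [|t]; simpl in HB;
      destruct (isubstD _ _) as [B1|] eqn:H1; simpl in HB; try discriminate;
      apply (isubstD_simple E') in H1; subst B1.
    + injection HB as <-; simpl; rewrite I_to_iotaK; tauto.
    + destruct (tm_isubst_related t E) as [Hs|[Hs Hr]]; rewrite Hs in HB; simpl in HB;
        [|discriminate].
      injection HB as <-; simpl; rewrite I_to_iotaK; tauto.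
Qed.

End Replacement.

Lemma iinstD_iff (F A : formD Sg 1) B G t :
  iinstD A (TIota F) = Some B ->
  entailsI G (instI (iota_to_I F) t) -> entailsI G (IExt t) ->
  entailsI G (unique (iota_to_I F) t) ->
  entailsI G (instI (iota_to_I A) t) <-> entailsI G (iota_to_I B).
Proof.
  intros HB; rewrite <- (iota_to_IK A) in HB.
  apply isubstD_iff with (2 := HB).
  intros i; right; rewrite iota_to_IK; auto.
Qed.

Lemma iinstD_simple_inv (A : formD Sg 1) t B :
  iinstD A (TSim t) = Some B -> iota_to_I B = instI (iota_to_I A) t.
Proof.
  rewrite <- (iota_to_IK A), iinstD_simple; intros [= <-]; rewrite !I_to_iotaK; reflexivity.
Qed.

Lemma eqE_iota G (F A : formD Sg 1) t B :
  atomicD A -> iinstD A (TIota F) = Some B ->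
  entailsI G (IThe (iota_to_I F) (ScEq t)) -> entailsI G (instI (iota_to_I A) t) ->
  entailsI G (iota_to_I B).
Proof.
  intros HA HB; rewrite <- (iota_to_IK A) in HB.
  apply isubstD_eqE with (2 := atomic_iota_to_I HA) (3 := HB).
  intros i; right; rewrite iota_to_IK; auto.
Qed.

End FromI.

(** * [Ix[F,G]] in the system with [ι]-terms *)

Section FromIota.
Context {Sg : signature} (H : sequent (formD Sg 0) -> Prop).

Definition entailsD (G : list (formI Sg 0)) (A : formI Sg 0) : Prop :=
  derives (@IPF_iotaR Sg) H (map I_to_iota G, I_to_iota A).

Ltac by_rule r :=
  intros; eapply d_rule;
  [eapply r; eauto using atomic_I_to_iota
  |let p := fresh in let Hp := fresh in
   intros p Hp; simpl in Hp; repeat (destruct Hp as [<-|Hp]; [eassumption|]); destruct Hp].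

Lemma entailsD_closed : IPF_closed entailsD.
Proof.
  unfold entailsD; split; simpl.
  - intros; apply d_assume, in_map; assumption.
  - intros; eapply d_weaken; [apply incl_map|]; eassumption.
  - by_rule D_andI.
  - by_rule D_andE1.
  - by_rule D_andE2.
  - by_rule D_impI.
  - by_rule D_impE.
  - by_rule D_orI1.
  - by_rule D_orI2.
  - by_rule D_orE.
  - by_rule D_iffI.
  - by_rule D_iffE1.
  - by_rule D_iffE2.
  - by_rule D_botE.
  - intros G A a HG HA; apply fresh_I_to_iota in HG.
    rewrite <- occurs_I_to_iota in HA; rewrite I_to_iota_inst; by_rule D_allI.
  - intros G A t; assert (HB := iinstD_simple A t); by_rule D_allE.
  - intros G A t; assert (HB := iinstD_simple A t); by_rule D_exI.
  - intros G A C a HG HA HC; apply fresh_I_to_iota in HG.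
    rewrite <- occurs_I_to_iota in HA, HC; rewrite I_to_iota_inst; by_rule D_exE.
  - by_rule D_eqI.
  - intros G A t u HA E HB; rewrite I_to_iota_inst in HB.
    apply d_rule with (1 := D_eqE _ (t1 := t) (t2 := TSim u) (atomic_I_to_iota HA)
      eq_refl (iinstD_simple A u)).
    intros p [<-|[<-|[]]]; assumption.
Qed.

Local Notation HP := entailsD_closed.

Lemma allE_iota G (F A : formI Sg 1) B :
  iinstD (I_to_iota A) (TIota (I_to_iota F)) = Some (I_to_iota B) ->
  entailsD G (IAll A) -> entailsD G (IThe F ScEx) -> entailsD G B.
Proof.
  intros HB HA HF; apply d_rule with (1 := D_allE _ HB).
  intros p [<-|[<-|[]]]; assumption.
Qed.

(** Lambert's Law allows [y] in its formula; here [F] is first shifted past [y] and returns to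
    itself when [y] becomes [t]. *)
Lemma Lambert_inst G F t :
  entailsD G (IExt t) -> entailsD G (IIff (IThe F (ScEq t)) (exactly F t)).
Proof.
  intro Ht; set (F' := substI (up shift_var) F).
  assert (HL : entailsD G (IAll (IIff (IThe F' (ScEq var0))
                                  (IAll (IIff F' (IEq var0 (tm_shift var0))))))).
  { apply d_rule with (1 := D_Lambert _ (I_to_iota F')); intros p []. }
  assert (HI := allE HP HL Ht); unfold instI, F' in HI; simpl in HI.
  rewrite substI_shift_inst in HI; exact HI.
Qed.

Lemma iota_eqI G F t :
  entailsD G (IExt t) -> entailsD G (instI F t) -> entailsD G (unique F t) ->
  entailsD G (IThe F (ScEq t)).
Proof.
  intros Ht HF HU; exact (iffE2 HP (Lambert_inst F Ht) (exactlyI HP HF HU)).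
Qed.

Lemma iota_eq_exactly G F t :
  entailsD G (IExt t) -> entailsD G (IThe F (ScEq t)) -> entailsD G (exactly F t).
Proof. intros Ht HI; exact (iffE1 HP (Lambert_inst F Ht) HI). Qed.

(** Leibniz's Law may not replace [ιxF], but it may put [ιxF] for [t] in [∃!t]. *)
Lemma iota_exists G F t :
  entailsD G (IExt t) -> entailsD G (IThe F (ScEq t)) -> entailsD G (IThe F ScEx).
Proof.
  intros Ht HI.
  apply d_rule with (1 := D_eqE (A := DExt (TSim var0)) _ (t1 := t)
    (t2 := TIota (I_to_iota F)) I eq_refl eq_refl).
  intros p [<-|[<-|[]]]; assumption.
Qed.

Lemma iota_eq_subst G F t u :
  entailsD G (IEq t u) -> entailsD G (IThe F (ScEq t)) -> entailsD G (IThe F (ScEq u)).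
Proof.
  intros E HI.
  assert (HL := leibniz HP (A := IThe (substI (up shift_var) F) (ScEq var0)) E).
  unfold instI in HL; simpl in HL; rewrite !substI_shift_inst in HL; exact (HL HI).
Qed.

(* Leibniz's Law does not apply to [ιxF]; instead [∀x∃y(y = x)] is instantiated with it. *)
Lemma iota_ex G F :
  entailsD G (IThe F ScEx) -> entailsD G (IEx (IThe (substI (up shift_var) F) (ScEq var0))).
Proof.
  apply (allE_iota (A := IEx (IEq var0 (tm_shift var0)))).
  - cbn; rewrite I_to_iota_subst; reflexivity.
  - destruct (fresh_exists G) as [a Ha]; apply (allI HP Ha); [simpl|].
    + intros [E|E]; discriminate.
    + apply (exI HP) with (t := Par a); [apply (eqI HP)|apply (assume_hd HP)].
Qed.

(* Likewise with [∀x(t = x → x = u → t = u)]. *)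
Lemma iota_eq_value G F t u :
  entailsD G (IThe F ScEx) -> entailsD G (IThe F (ScEq t)) -> entailsD G (IThe F (ScEq u)) ->
  entailsD G (IEq t u).
Proof.
  intros HF Ht Hu; refine (impE HP (impE HP _ Ht) Hu).
  revert HF; apply (allE_iota (A := IImp (IEq (tm_shift t) var0)
    (IImp (IEq var0 (tm_shift u)) (IEq (tm_shift t) (tm_shift u))))).
  - destruct t as [[]| |], u as [[]| |]; reflexivity.
  - destruct (fresh_exists (IEq t u :: G)) as [a Ha]; apply fresh_cons in Ha as [Ha HG].
    apply (allI HP HG).
    + intro Ho; apply Ha; simpl in Ho |- *.
      destruct t as [[]| |], u as [[]| |]; unfold tm_shift in Ho; simpl in Ho |- *;
        intuition (try discriminate; congruence).
    + unfold instI; simpl; rewrite !tm_shift_inst.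
      do 2 apply (impI HP); apply (eq_trans HP) with (u := Par a);
        [apply (weaken_cons HP)|]; apply (assume_hd HP).
Qed.

(** Some [a] has [ιxF = a] by [iota_ex]; Lambert's Law makes it the only F, so [t = a] and
    [u = a]. *)
Lemma iota_unique G F t u :
  entailsD G (IThe F ScEx) -> entailsD G (IExt t) -> entailsD G (IExt u) ->
  entailsD G (instI F t) -> entailsD G (instI F u) -> entailsD G (IEq t u).
Proof.
  intros HI Ht Hu HFt HFu; set (E := IThe (substI (up shift_var) F) (ScEq var0)).
  destruct (fresh_exists (IEx E :: IEq t u :: G)) as [a Ha].
  apply fresh_cons in Ha as [Ha1 Ha]; apply fresh_cons in Ha as [Ha2 HG].
  refine (exE HP HG _ Ha2 (iota_ex HI) _); [exact Ha1|].
  unfold E, instI; simpl; rewrite substI_shift_inst; simpl.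
  set (D := _ :: _ :: G).
  assert (HU : entailsD D (unique F (Par a))).
  { apply (exactly_unique HP), iota_eq_exactly; apply (assume HP); simpl; auto. }
  assert (HD : forall A, entailsD G A -> entailsD D A)
    by (intros A HA; do 2 apply (weaken_cons HP); exact HA).
  apply (eq_trans HP) with (u := Par a); [|apply (eq_sym HP)];
    apply (uniqueE HP HU); auto.
Qed.

(** The value [a] of [ιxF] obtained from [iota_ex] is the witness, and Lambert's Law gives
    [F^x_a]. *)
Lemma iota_ex_inst G F : entailsD G (IThe F ScEx) -> entailsD G (IEx F).
Proof.
  intro HI; set (E := IThe (substI (up shift_var) F) (ScEq var0)).
  destruct (fresh_exists (IEx E :: IEx F :: G)) as [a Ha].
  apply fresh_cons in Ha as [Ha1 Ha]; apply fresh_cons in Ha as [Ha2 HG].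
  refine (exE HP HG _ Ha2 (iota_ex HI) _); [exact Ha1|].
  unfold E, instI; simpl; rewrite substI_shift_inst; simpl.
  set (D := _ :: _ :: G).
  assert (Ht : entailsD D (IExt (Par a))) by (apply (assume HP); simpl; auto).
  apply (exI HP) with (t := Par a); [|exact Ht].
  apply (exactly_inst HP Ht), (iota_eq_exactly Ht), (assume_hd HP).
Qed.

(** This simulates [II]. Lambert's Law yields [ιxF = t]; Leibniz's Law then gives [∃!ιxF], or turns
    [t] into [u]. *)
Lemma iota_intro G F (K : scope Sg 0) t :
  entailsD G (IExt t) -> entailsD G (instI F t) -> entailsD G (instI (scope_form K) t) ->
  entailsD G (unique F t) -> entailsD G (IThe F K).
Proof.
  intros Ht HF HK HU; assert (HI := iota_eqI Ht HF HU); destruct K as [|u].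
  - exact (iota_exists Ht HI).
  - unfold instI in HK; simpl in HK; rewrite tm_shift_inst in HK.
    exact (iota_eq_subst HK HI).
Qed.

(** Needed for [IE1p]. In the identity case [ιxF] has both [t] and [u] as values, and
    [iota_eq_value] equates them. *)
Lemma iota_scope G F (K : scope Sg 0) t :
  entailsD G (IThe F K) -> entailsD G (IExt t) -> entailsD G (instI F t) ->
  entailsD G (unique F t) -> entailsD G (instI (scope_form K) t).
Proof.
  intros HK Ht HF HU; destruct K as [|u]; [exact Ht|].
  unfold instI; simpl; rewrite tm_shift_inst.
  assert (HI := iota_eqI Ht HF HU).
  exact (iota_eq_value (iota_exists Ht HI) HI HK).
Qed.

End FromIota.

(** * Equivalence *)

Section Simulation.
Context {Sg : signature}.

Lemma IPF_IR_in_iotaR (ps : list (sequent (formI Sg 0))) s :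
  IPF_IR ps s ->
  derives (@IPF_iotaR Sg)
    (fun q => In q (map (map_sequent I_to_iota) ps)) (map_sequent I_to_iota s).
Proof.
  intro HR; set (H := fun q => In q (map (map_sequent I_to_iota) ps)).
  assert (Hp : forall G A, In (G, A) ps -> entailsD H G A)
    by (intros G A HA; apply d_hyp; exact (in_map (map_sequent I_to_iota) _ _ HA)).
  assert (HP := entailsD_closed H); clearbody H.
  enough (entailsD H (fst s) (snd s)) by (destruct s; assumption).
  destruct HR; simpl.
  - apply (andI HP); apply Hp; simpl; auto.
  - eapply (andE1 HP); apply Hp; simpl; eauto.
  - eapply (andE2 HP); apply Hp; simpl; eauto.
  - apply (impI HP); apply Hp; simpl; auto.
  - eapply (impE HP); apply Hp; simpl; eauto.
  - apply (orI1 HP); apply Hp; simpl; auto.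
  - apply (orI2 HP); apply Hp; simpl; auto.
  - eapply (orE HP); apply Hp; simpl; eauto.
  - apply (iffI HP); apply Hp; simpl; auto.
  - eapply (iffE1 HP); apply Hp; simpl; eauto.
  - eapply (iffE2 HP); apply Hp; simpl; eauto.
  - apply (botE HP); [assumption|apply Hp; simpl; auto].
  - eapply (allI HP); [eassumption|assumption|apply Hp; simpl; auto].
  - apply (allE HP); apply Hp; simpl; auto.
  - eapply (exI HP); apply Hp; simpl; eauto.
  - eapply (exE HP); [eassumption|..]; try eassumption; apply Hp; simpl; auto.
  - apply (eqI HP).
  - eapply (eqE HP); [assumption|..]; apply Hp; simpl; eauto.
  - apply iota_intro with (t := t); try (apply Hp; simpl; auto; fail).
    eapply (uniqueI HP); try eassumption; apply Hp; simpl; auto 6.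
  - assert (HU : entailsD H G (unique F t))
      by (apply (uniqueI HP) with (a := a); try assumption; apply Hp; simpl; auto 6).
    assert (Ht : entailsD H G (IExt t)) by (apply Hp; simpl; auto).
    assert (HF : entailsD H G (instI F t)) by (apply Hp; simpl; auto).
    (* [IE1p] becomes [∃E] on [∃x(F ∧ G)], with [t] as witness and [b] as its parameter. *)
    apply (exE HP) with (A := IAnd F (scope_form K)) (a := b); try assumption.
    + simpl; intros [Ho|Ho]; [tauto|].
      destruct K as [|u]; simpl in *; [discriminate|].
      destruct Ho as [Ho|Ho]; [discriminate|apply tm_shift_Par in Ho; tauto].
    + apply (exI HP) with (t := t); [|exact Ht].
      apply (andI HP); [exact HF|].
      apply iota_scope with (F := F); try assumption; apply Hp; simpl; auto.
    + set (A1 := instI F (Par b)); set (A2 := instI (scope_form K) (Par b)).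
      change (instI (IAnd F (scope_form K)) (Par b)) with (IAnd A1 A2).
      (* The given subdeduction assumes [F^x_b] and [G^x_b] separately, so its assumptions are
         discharged into a chain of implications, which the conjunction then feeds. *)
      assert (HC : entailsD H G (IImp (IExt (Par b)) (IImp A2 (IImp A1 C))))
        by (do 3 apply (impI HP); apply Hp; simpl; auto 6).
      refine (impE HP (impE HP (impE HP (weaken HP _ HC) _) _) _).
      * do 2 apply incl_tl; apply incl_refl.
      * apply (assume HP); simpl; auto.
      * eapply (andE2 HP), (assume_hd HP).
      * eapply (andE1 HP), (assume_hd HP).
  (* [IE2p]: uniqueness gives [t1 = t2], and Leibniz's Law does the rest. *)
  - apply (eqE HP) with (t := t1); [assumption| |apply Hp; simpl; auto 7].
    apply iota_unique with (F := F); apply Hp; simpl; auto 7.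
  - apply (exE HP) with (A := F) (a := a); try assumption; [|apply Hp; simpl; auto].
    apply iota_ex_inst, Hp; simpl; auto.
  (* [IE4p]: by Lambert's Law [t2] is the only F, hence [t1 = t2]. *)
  - apply (eqE HP) with (t := t1); [assumption| |apply Hp; simpl; auto 6].
    apply (uniqueE HP) with (F := F); [|apply Hp; simpl; auto 6..].
    apply (exactly_unique HP), iota_eq_exactly; apply Hp; simpl; auto.
  - assert (Ht : entailsD H G (IExt t)) by (apply Hp; simpl; auto).
    apply (exE HP) with (A := F) (a := a); try assumption; [|apply Hp; simpl; auto].
    apply (exI HP) with (t := t); [|exact Ht].
    apply (exactly_inst HP Ht), (iota_eq_exactly Ht), Hp; simpl; auto.
Qed.

Lemma tmD_cases n (t : tmD Sg n) : (exists u, t = TSim u) \/ (exists F, t = TIota F).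
Proof. destruct t; eauto. Qed.

Lemma IPF_iotaR_in_IR (ps : list (sequent (formD Sg 0))) s :
  IPF_iotaR ps s ->
  derives (@IPF_IR Sg)
    (fun q => In q (map (map_sequent iota_to_I) ps)) (map_sequent iota_to_I s).
Proof.
  intro HR; set (H := fun q => In q (map (map_sequent iota_to_I) ps)).
  assert (Hp : forall G A, In (G, A) ps -> entailsI H (map iota_to_I G) (iota_to_I A))
    by (intros G A HA; apply d_hyp; exact (in_map (map_sequent iota_to_I) _ _ HA)).
  assert (HP := entailsI_closed H); clearbody H.
  enough (entailsI H (map iota_to_I (fst s)) (iota_to_I (snd s))) by (destruct s; assumption).
  destruct HR as [G A B|G A B|G A B|G A B|G A B|G A B|G A B|G A B C|G A B|G A B|G A B
    |G A HA|G A a HG HA|G A t B HB|G A t B HB|G A C a HG HA HC|G t|G A t1 t2 E B HA HE HB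
    |G F]; simpl.
  - apply (andI HP); apply Hp; simpl; auto.
  - apply (andE1 HP) with (B := iota_to_I B), (Hp G (DAnd A B)); simpl; auto.
  - apply (andE2 HP) with (A := iota_to_I A), (Hp G (DAnd A B)); simpl; auto.
  - apply (impI HP), (Hp (A :: G) B); simpl; auto.
  - apply (impE HP) with (A := iota_to_I A);
      [apply (Hp G (DImp A B))|apply Hp]; simpl; auto.
  - apply (orI1 HP), Hp; simpl; auto.
  - apply (orI2 HP), Hp; simpl; auto.
  - apply (orE HP) with (A := iota_to_I A) (B := iota_to_I B);
      [apply (Hp G (DOr A B))|apply (Hp (A :: G) C)|apply (Hp (B :: G) C)]; simpl; auto.
  - apply (iffI HP); [apply (Hp (A :: G) B)|apply (Hp (B :: G) A)]; simpl; auto.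
  - apply (iffE1 HP) with (A := iota_to_I A);
      [apply (Hp G (DIff A B))|apply Hp]; simpl; auto.
  - apply (iffE2 HP) with (B := iota_to_I B);
      [apply (Hp G (DIff A B))|apply Hp]; simpl; auto.
  - apply (botE HP); [apply atomic_iota_to_I, HA|apply (Hp G DBot); simpl; auto].
  - apply (allI HP) with (a := a);
      [apply fresh_iota_to_I, HG|rewrite occurs_iota_to_I; exact HA|].
    rewrite <- iota_to_I_inst; apply (Hp (DExt (TSim (Par a)) :: G)); simpl; auto.
  - assert (HA : entailsI H (map iota_to_I G) (IAll (iota_to_I A)))
      by (apply (Hp G (DAll A)); simpl; auto).
    assert (Ht : entailsI H (map iota_to_I G) (iota_to_I (DExt t)))
      by (apply Hp; simpl; auto).
    destruct (tmD_cases t) as [[u ->]|[F ->]]; simpl in Ht.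
    + rewrite (iinstD_simple_inv HB); apply (allE HP); assumption.
    (* [∀E] for [ιxF]: pass to a parameter [a] that is the only F, instantiate there, and replace
       [a] by [ιxF]. *)
    + apply theEx_elim with (1 := Ht); intros a D HD HF Ha HU.
      apply (iinstD_iff HB HF Ha HU), (allE HP); [apply (weaken HP HD), HA|exact Ha].
  - assert (HA : entailsI H (map iota_to_I G) (iota_to_I B)) by (apply Hp; simpl; auto).
    assert (Ht : entailsI H (map iota_to_I G) (iota_to_I (DExt t)))
      by (apply Hp; simpl; auto).
    destruct (tmD_cases t) as [[u ->]|[F ->]]; simpl in Ht.
    + apply (exI HP) with (t := u); [rewrite <- (iinstD_simple_inv HB)|]; assumption.
    (* [∃I] for [ιxF]: the premiss about [ιxF] becomes one about [a], which is the witness. *)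
    + apply theEx_elim with (1 := Ht); intros a D HD HF Ha HU.
      apply (exI HP) with (t := Par a); [|exact Ha].
      apply (iinstD_iff HB HF Ha HU), (weaken HP HD), HA.
  - apply (exE HP) with (A := iota_to_I A) (a := a);
      [apply fresh_iota_to_I, HG|rewrite occurs_iota_to_I; exact HA
      |rewrite occurs_iota_to_I; exact HC|apply (Hp G (DEx A)); simpl; auto|].
    rewrite <- iota_to_I_inst.
    apply (Hp (instD A (Par a) :: DExt (TSim (Par a)) :: G)); simpl; auto.
  - apply (eqI HP).
  - assert (Ht : entailsI H (map iota_to_I G) (iota_to_I E)) by (apply Hp; simpl; auto).
    assert (HA1 : entailsI H (map iota_to_I G) (instI (iota_to_I A) t1))
      by (rewrite <- iota_to_I_inst; apply Hp; simpl; auto).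
    destruct (tmD_cases t2) as [[u ->]|[F ->]]; injection HE as <-; simpl in Ht.
    + rewrite (iinstD_simple_inv HB).
      apply (eqE HP) with (t := t1); [apply atomic_iota_to_I, HA|exact Ht|exact HA1].
    + exact (eqE_iota HA HB Ht HA1).
  - apply Lambert_derivable.
Qed.

End Simulation.

Theorem theorem3 (Sg : signature) :
  (forall (ps : list (sequent (formI Sg 0))) (s : sequent (formI Sg 0)),
     IPF_IR ps s ->
     derives (@IPF_iotaR Sg)
       (fun q => In q (map (map_sequent I_to_iota) ps)) (map_sequent I_to_iota s)) /\
  (forall (ps : list (sequent (formD Sg 0))) (s : sequent (formD Sg 0)),
     IPF_iotaR ps s ->
     derives (@IPF_IR Sg)
       (fun q => In q (map (map_sequent iota_to_I) ps)) (map_sequent iota_to_I s)) /\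
  (forall (T : formI Sg 0 -> Prop) (A : formI Sg 0),
     derivable (@IPF_IR Sg) T A <->
     derivable (@IPF_iotaR Sg) (image I_to_iota T) (I_to_iota A)) /\
  (forall (T : formD Sg 0 -> Prop) (A : formD Sg 0),
     derivable (@IPF_iotaR Sg) T A <->
     derivable (@IPF_IR Sg) (image iota_to_I T) (iota_to_I A)).
Proof.
  assert (H1 := @IPF_IR_in_iotaR Sg); assert (H2 := @IPF_iotaR_in_IR Sg).
  refine (conj H1 (conj H2 (conj _ _))).
  - exact (derivable_iff H1 H2 (@I_to_iotaK Sg 0)).
  - exact (derivable_iff H2 H1 (@iota_to_IK Sg 0)).
Qed.
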